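(* For any $A\in M$ and any $B\in\mathrm{End}(V)$ commuting with $p_\pi$ one has $$\mathrm{Tr}_{Q_U}\big((A\otimes B)P_U\big)=\frac{\mathrm{Tr}_M(A)}{N!}\,\mathrm{tr}_{\mathrm{End}(V)}(Bp_\pi).$$
   Context: Let $N$ be a natural number. The braid group $B_N$ is generated by $b_1,\dots,b_{N-1}$ with relations $b_ib_j=b_jb_i$ for $|i-j|\ge2$ and $b_ib_jb_i=b_jb_ib_j$ for $|i-j|=1$; $\phi:B_N\to S_N$ is the canonical homomorphism onto the symmetric group (the quotient by the relations $b_i^2=1$); $B_N^{pure}=\ker\phi$. Let $\mathfrak S$ be a unitary representation of $S_N$ in a separable Hilbert space $H$, $\pi$ a unitary representation of $B_N$ in a finite-dimensional Hilbert space $V$, and $U$ the unitary representation of $B_N$ in $H\otimes V$ given by $U(b_i)(\xi\otimes v)=\mathfrak S(\phi(b_i))\xi\otimes\pi(b_i)v$. $P_U$ is the orthogonal projection of $H\otimes V$ onto the subspace $(H\otimes V)_U=\{f\in H\otimes V: U(b_i)f=f,\ i=1,\dots,N-1\}$; $p_\pi$ is the projection of $V$ onto $V^\pi=\{v\in V:\pi(\beta)v=v\ \text{for all}\ \beta\in B_N^{pure}\}$. $M$ is a $\mathrm{II}_\infty$ factor acting in $H$, and it is assumed that the operators $\mathfrak S(\sigma)$, $\sigma\in S_N$, $\sigma\ne e$, do not belong to $M$. $M\rtimes_\alpha S_N$ (also written $M\rtimes S_N$) is the crossed product of $M$ by the action $\alpha$ of $S_N$ by automorphisms of $M$ given by $\alpha_\sigma(x)=\mathfrak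 S(\sigma)x\mathfrak S(\sigma)^*$, $x\in M$. $Q=M\otimes\mathrm{End}(V)$, and $Q_U=\{Q,\{U(\beta)\}_{\beta\in B_N}\}''$ is the von Neumann algebra generated by $Q$ and the operators $U(\beta)$, $\beta\in B_N$; it is identified with $(M\rtimes_\alpha S_N)\otimes\mathrm{End}(V)$, with $\mathfrak S(\sigma)$ implementing the crossed product. $\mathrm{Tr}_K$ denotes the faithful normal semifinite trace on a $\mathrm{II}_\infty$ factor $K$; $\mathrm{tr}_{\mathrm{End}(V)}$ is the trace on $\mathrm{End}(V)$ normalized by $\mathrm{tr}_{\mathrm{End}(V)}(1)=1$; $\mathrm{Tr}_{Q_U}$ is the product of $\mathrm{Tr}_{M\rtimes S_N}$ and $\mathrm{tr}_{\mathrm{End}(V)}$, where $\mathrm{Tr}_{M\rtimes S_N}(x\,\mathfrak S(\sigma))=\delta_{e,\sigma}\mathrm{Tr}_M(x)$ for $x\in M$, $\sigma\in S_N$. *)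

(* Defs.v *)
(* The scalars are C = R[i] for a [realType] R.  Inner products are linear in the first variable.  An operator
   on E is a plain function E -> E, and a set of operators is a [set (E -> E)]. *)
Set Warnings "-notation-overridden,-ambiguous-paths,-notation-incompatible-prefix,-redundant-canonical-projection".
From HB Require Import structures.
From mathcomp Require Import all_boot all_order all_algebra all_fingroup.
From mathcomp Require Import generic_quotient sesquilinear.
From mathcomp Require Import all_classical all_reals all_analysis.
From mathcomp Require Import complex zify.

Set Implicit Arguments.
Unset Strict Implicit.
Unset Printing Implicit Defensive.

Import Order.TTheory GRing.Theory Num.Theory.
Import numFieldNormedType.Exports.

Local Open Scope classical_set_scope.
Local Open Scope ring_scope.
Local Open Scope quotient_scope.

Section BraidGroup.
Variable N : nat.

(* The letter (i, true) is b_{i+1} and (i, false) is its inverse. *)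
Definition braid_word := seq ('I_N.-1 * bool).

Definition braid_letter (i : 'I_N.-1) : braid_word := [:: (i, true)].

Inductive braid_equiv : braid_word -> braid_word -> Prop :=
| BraidRefl u : braid_equiv u u
| BraidSym u v : braid_equiv u v -> braid_equiv v u
| BraidTrans v u w : braid_equiv u v -> braid_equiv v w -> braid_equiv u w
| BraidCat u u' v v' :
    braid_equiv u u' -> braid_equiv v v' -> braid_equiv (u ++ v) (u' ++ v')
| BraidCancel i e : braid_equiv [:: (i, e); (i, ~~ e)] [::]
| BraidFar (i j : 'I_N.-1) : (i.+1 < j)%N || (j.+1 < i)%N ->
    braid_equiv (braid_letter i ++ braid_letter j)
                (braid_letter j ++ braid_letter i)
| BraidNear (i j : 'I_N.-1) : (i.+1 == j)%N || (j.+1 == i)%N ->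
    braid_equiv (braid_letter i ++ braid_letter j ++ braid_letter i)
                (braid_letter j ++ braid_letter i ++ braid_letter j).

Definition braid_rel : rel braid_word := fun u v => `[< braid_equiv u v >].

Lemma braid_rel_refl : reflexive braid_rel.
Proof. by move=> u; apply/asboolP/BraidRefl. Qed.

Lemma braid_rel_sym : symmetric braid_rel.
Proof.
by move=> u v; apply/asboolP/asboolP => uv; apply: BraidSym.
Qed.

Lemma braid_rel_trans : transitive braid_rel.
Proof.
move=> v u w /asboolP uv /asboolP vw; apply/asboolP; exact: BraidTrans uv vw.
Qed.

Canonical braid_equiv_rel :=
  EquivRel braid_rel braid_rel_refl braid_rel_sym braid_rel_trans.

Definition braid := {eq_quot braid_equiv_rel}.

HB.instance Definition _ := Choice.on braid.
HB.instance Definition _ := EqQuotient.on braid.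

Lemma braid_eqP (u v : braid_word) :
  (\pi_braid u = \pi_braid v) <-> braid_equiv u v.
Proof.
split=> [uv|uv]; last by apply/eqmodP/asboolP.
by apply/asboolP; move/eqmodP: uv.
Qed.

Lemma braid_repr (u : braid_word) : braid_equiv (repr (\pi_braid u)) u.
Proof. by apply/braid_eqP; rewrite reprK. Qed.

Definition braid_mul (x y : braid) : braid := \pi_braid (repr x ++ repr y).

Definition braid_inv_word (u : braid_word) : braid_word :=
  rev [seq (x.1, ~~ x.2) | x <- u].

Definition braid_inv (x : braid) : braid := \pi_braid (braid_inv_word (repr x)).

Lemma braid_inv_wordVw u : braid_equiv (braid_inv_word u ++ u) [::].
Proof.
elim: u => [|[i e] u IH]; first exact: BraidRefl.
rewrite /braid_inv_word /= rev_cons cat_rcons.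
apply: BraidTrans (IH); apply: BraidCat; first exact: BraidRefl.
rewrite -[(i, ~~ e) :: _]/([:: (i, ~~ e); (i, e)] ++ u) -[X in braid_equiv _ X]cat0s.
apply: BraidCat (BraidRefl _).
by rewrite -{2}[e]negbK; apply: BraidCancel.
Qed.

Lemma braid_inv_wordwV u : braid_equiv (u ++ braid_inv_word u) [::].
Proof.
have invK : braid_inv_word (braid_inv_word u) = u.
  rewrite /braid_inv_word map_rev revK -map_comp -[RHS]map_id.
  by apply: eq_map => -[i e] /=; rewrite negbK.
by rewrite -{1}invK; apply: braid_inv_wordVw.
Qed.

Lemma braid_mulA : associative braid_mul.
Proof.
move=> x y z; apply/braid_eqP.
apply: (@BraidTrans (repr x ++ repr y ++ repr z)).
  exact: BraidCat (BraidRefl _) (braid_repr _).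
by rewrite catA; apply/BraidSym/BraidCat/BraidRefl/braid_repr.
Qed.

Lemma braid_mul1g : left_id (\pi_braid [::]) braid_mul.
Proof.
move=> x; rewrite -[RHS]reprK; apply/braid_eqP.
exact: (BraidCat (braid_repr [::]) (BraidRefl (repr x))).
Qed.

Lemma braid_mulg1 : right_id (\pi_braid [::]) braid_mul.
Proof.
move=> x; rewrite -[RHS]reprK; apply/braid_eqP; rewrite -[X in braid_equiv _ X]cats0.
exact: (BraidCat (BraidRefl (repr x)) (braid_repr [::])).
Qed.

Lemma braid_mulVg : left_inverse (\pi_braid [::]) braid_inv braid_mul.
Proof.
move=> x; apply/braid_eqP; apply: BraidTrans (braid_inv_wordVw (repr x)).
exact: BraidCat (braid_repr _) (BraidRefl _).
Qed.

Lemma braid_mulgV : right_inverse (\pi_braid [::]) braid_inv braid_mul.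
Proof.
move=> x; apply/braid_eqP; apply: BraidTrans (braid_inv_wordwV (repr x)).
exact: BraidCat (BraidRefl _) (braid_repr _).
Qed.

HB.instance Definition _ := isGroup.Build braid
  braid_mulA braid_mul1g braid_mulg1 braid_mulVg braid_mulgV.

Definition braid_gen (i : 'I_N.-1) : braid := \pi_braid (braid_letter i).

Lemma ltn_ord_succ (i : 'I_N.-1) : (i.+1 < N)%N.
Proof. by case: N i => [[]//|n i] /=; rewrite ltnS. Qed.

Definition adj_transp (i : 'I_N.-1) : 'S_N :=
  tperm (Ordinal (ltnW (ltn_ord_succ i))) (Ordinal (ltn_ord_succ i)).

(* A transposition is its own inverse, so the signs of the letters are ignored. *)
Definition word_perm (u : braid_word) : 'S_N :=
  (\prod_(x <- u) adj_transp x.1)%g.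

Definition braid_perm (x : braid) : 'S_N := word_perm (repr x).


Lemma tperm_swap (T : finType) (a b c : T) : a != b -> b != c -> a != c ->
  (tperm a b * tperm b c * tperm a b = tperm a c)%g.
Proof.
move=> ab bc ac; rewrite -{1}(tpermV a b) -mulgA -[LHS]/(conjg _ _) tpermJ.
by rewrite tpermR tpermD // eq_sym.
Qed.

Lemma adj_transp_far (i j : 'I_N.-1) : (i.+1 < j)%N ->
  (adj_transp i * adj_transp j = adj_transp j * adj_transp i)%g.
Proof.
move=> ij; apply/commgP/conjg_fixP; rewrite /adj_transp tpermJ.
by rewrite !tpermD // -val_eqE /=; lia.
Qed.

Lemma adj_transp_near (i j : 'I_N.-1) : i.+1 = j ->
  (adj_transp i * adj_transp j * adj_transp i =
   adj_transp j * adj_transp i * adj_transp j)%g.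
Proof.
move=> ij; rewrite /adj_transp.
set a := Ordinal (ltnW (ltn_ord_succ i)); set b := Ordinal (ltn_ord_succ i).
set c := Ordinal (ltn_ord_succ j).
have -> : Ordinal (ltnW (ltn_ord_succ j)) = b by apply/val_inj; rewrite /= ij.
rewrite tperm_swap -?val_eqE /=; try lia.
rewrite (tpermC a b) (tpermC b c) tperm_swap ?(tpermC a c) // -?val_eqE /=; lia.
Qed.

Lemma word_perm_equiv u v : braid_equiv u v -> word_perm u = word_perm v.
Proof.
elim=> {u v} //.
- by move=> v u w _ -> _ ->.
- move=> u u' v v' _ IHu _ IHv; rewrite /word_perm !big_cat /=.
  by congr (_ * _)%g.
- by move=> i e; rewrite /word_perm !big_cons big_nil /= mulg1 tperm2.
- move=> i j /orP ij; rewrite /word_perm !big_cat /= !big_seq1 /=.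
  by case: ij => ij; [exact: adj_transp_far | rewrite -adj_transp_far].
- move=> i j /orP ij; rewrite /word_perm !big_cat /= !big_seq1 /= !mulgA.
  by case: ij => /eqP ij; rewrite (adj_transp_near ij).
Qed.

Lemma braid_permE u : braid_perm (\pi_braid u) = word_perm u.
Proof. exact/word_perm_equiv/braid_repr. Qed.

Lemma braid_perm_gen i : braid_perm (braid_gen i) = adj_transp i.
Proof. by rewrite braid_permE /word_perm big_seq1. Qed.

Lemma braid_permM : {morph braid_perm : x y / (x * y)%g}.
Proof. by move=> x y; rewrite braid_permE /word_perm big_cat. Qed.

Definition pure_braid : set braid := [set x | braid_perm x = 1%g].

End BraidGroup.

Section Operators.
Variables (R : realType) (E : lmodType R[i]) (ip : E -> E -> R[i]).
Implicit Types (T X Y : E -> E) (S M : set (E -> E)).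

Definition bounded_op T :=
  linear T /\ exists k : R[i], forall x, ip (T x) (T x) <= k * ip x x.

Definition adjoint T T' := forall x y, ip (T x) y = ip x (T' y).

Definition positive_op T := forall x, 0 <= ip (T x) x.

Definition op_le X Y := forall x, ip (X x) x <= ip (Y x) x.

Definition is_orth_proj (W : set E) (P : E -> E) :=
  forall x, W (P x) /\ forall w, W w -> ip (x - P x) w = 0.

Definition unitary_rep (G : groupType) (rho : G -> E -> E) :=
  [/\ rho 1%g = id, forall g h, rho (g * h)%g = rho g \o rho h,
      forall g, linear (rho g) & forall g x y, ip (rho g x) (rho g y) = ip x y].

Definition commutant S : set (E -> E) :=
  [set T | bounded_op T /\ forall X, S X -> T \o X = X \o T].

Definition vN_gen S := commutant (commutant S).

Definition vN_algebra M :=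
  (forall T, M T -> exists2 T', M T' & adjoint T T') /\ vN_gen M = M.

Definition vN_factor M :=
  vN_algebra M /\ M `&` commutant M = range (fun (c : R[i]) (x : E) => c *: x).

Definition projection M (p : E -> E) := [/\ M p, p \o p = p & adjoint p p].

Definition proj_le (p q : E -> E) := q \o p = p.

Definition proj_equiv M (p q : E -> E) := exists v w,
  [/\ M v, M w, adjoint v w, w \o v = p & v \o w = q].

Definition finite_projection M p := projection M p /\
  forall q, projection M q -> proj_le q p -> proj_equiv M p q -> q = p.

Definition minimal_projection M p := [/\ projection M p, p <> 0 &
  forall q, projection M q -> proj_le q p -> q = 0 \/ q = p].

Definition II_infty_factor M :=
  [/\ vN_factor M, forall p, ~ minimal_projection M p,
      (exists2 p, finite_projection M p & p <> 0) & ~ finite_projection M id].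

Definition positive_cone M : set (E -> E) := [set x | M x /\ positive_op x].

Definition op_sup M (D : set (E -> E)) x := (forall y, D y -> op_le y x) /\
  forall z, positive_cone M z -> (forall y, D y -> op_le y z) -> op_le x z.

(* Faithful normal semifinite traces, with Dixmier's form of the axioms:
   invariance under the unitaries of M, normality along upward directed sets,
   and semifiniteness as a supremum over finite-trace minorants.  Only the
   values of tau on the positive cone of M matter. *)
Definition fns_trace M (tau : (E -> E) -> \bar R) :=
  let Mp := positive_cone M in
  [/\ [/\ forall x, Mp x -> (0 <= tau x)%E,
          forall x y, Mp x -> Mp y -> tau (x + y) = (tau x + tau y)%E,
          forall (c : R) x, 0 <= c -> Mp x ->
            tau (c%:C%C *: x) = (c%:E * tau x)%E &
          forall u u' x, M u -> M u' -> adjoint u u' ->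
            u \o u' = id -> u' \o u = id -> Mp x -> tau (u \o x \o u') = tau x],
      forall x, Mp x -> tau x = 0%E -> x = 0,
      forall D x, D `<=` Mp -> D !=set0 ->
        (forall y z, D y -> D z -> exists w, [/\ D w, op_le y w & op_le z w]) ->
        Mp x -> op_sup M D x -> tau x = ereal_sup [set tau y | y in D] &
      forall x, Mp x ->
        tau x = ereal_sup [set tau y | y in
                            [set y | [/\ Mp y, op_le y x & (tau y < +oo)%E]]]].

(* trace_val M tau x z : x lies in the definition ideal of tau, i.e., the linear
   span of the positive elements of finite trace, and the linear extension of
   tau takes the value z at x. *)
Definition trace_val M (tau : (E -> E) -> \bar R) (x : E -> E) (z : R[i]) :=
  let fin y := positive_cone M y /\ (tau y < +oo)%E in
  let t y := ((fine (tau y))%:C)%C in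
  exists a b c d, [/\ fin a, fin b, fin c & fin d] /\
    x = a - b + 'i *: (c - d) /\ z = t a - t b + 'i * (t c - t d).

Definition trace_ideal M tau : set (E -> E) := [set x | exists z, trace_val M tau x z].

Definition trace_ext M tau x : R[i] := xget 0 [set z | trace_val M tau x z].

End Operators.

Definition star_iso (R : realType) (E F : lmodType R[i])
    (ipE : E -> E -> R[i]) (ipF : F -> F -> R[i])
    (A : set (E -> E)) (B : set (F -> F)) (Theta : (E -> E) -> (F -> F)) :=
  [/\ set_bij A B Theta,
      forall (c : R[i]) x y, A x -> A y -> Theta (c *: x + y) = c *: Theta x + Theta y,
      forall x y, A x -> A y -> Theta (x \o y) = Theta x \o Theta y &
      forall x y, A x -> A y -> adjoint ipE x y -> adjoint ipF (Theta x) (Theta y)].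

Section Tensor.
Variables (R : realType) (E : lmodType R[i]) (V : vectType R[i]) (K : lmodType R[i]).
Variables (ipE : E -> E -> R[i]) (ipV : V -> V -> R[i]) (ipK : K -> K -> R[i]).
Variable t : E -> V -> K.

(* (K, t) is the Hilbert space tensor product of E and V; since V is
   finite-dimensional, no completion is involved. *)
Definition hilbert_tensor :=
  [/\ forall v, linear (t^~ v), forall xi, linear (t xi),
      forall xi eta v w, ipK (t xi v) (t eta w) = ipE xi eta * ipV v w &
      forall f, exists n (xi : 'I_n -> E) (v : 'I_n -> V),
        f = \sum_(i < n) t (xi i) (v i)].

(* a (x) b, for a bounded and b in End(V): the only operator satisfying the
   condition, as the vectors t xi v span K. *)
Definition tens_op (a : E -> E) (b : 'End(V)) : K -> K :=
  xget (id : K -> K)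
    [set T : K -> K | bounded_op ipK T /\ forall xi v, T (t xi v) = t (a xi) (b v)].

Definition tens_End (A : set (E -> E)) : set (K -> K) :=
  vN_gen ipK [set T | exists a b, A a /\ T = tens_op a b].

End Tensor.

Definition ntrace (R : realType) (V : vectType R[i]) (B : 'End(V)) : R[i] :=
  \tr (passmx.mxof (vbasis fullv) (vbasis fullv) B) / (\dim {:V})%:R.

Lemma ntrace1 (R : realType) (V : vectType R[i]) :
  (0 < \dim {:V})%N -> ntrace (\1%VF : 'End(V)) = 1.
Proof.
move=> V0; rewrite /ntrace (passmx.mxof1 (basis_free (vbasisP _))) mxtrace_scalar.
by rewrite divff// pnatr_eq0 -lt0n.
Qed.

Section CrossedProduct.
Variables (R : realType) (N : nat) (E : lmodType R[i]).

(* l^2(S_N, E) is carried by {ffun 'S_N -> E}. *)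
Definition l2_ip (ip : E -> E -> R[i]) (f g : {ffun 'S_N -> E}) : R[i] :=
  \sum_s ip (f s) (g s).

(* For E (x) V realized by t, l^2(S_N, E) (x) V is realized on l^2(S_N, K). *)
Definition l2_tensor (V : vectType R[i]) (K : lmodType R[i]) (t : E -> V -> K)
    (f : {ffun 'S_N -> E}) (v : V) : {ffun 'S_N -> K} := [ffun s => t (f s) v].

Variable S : 'S_N -> E -> E.

(* alpha_s(x) = S(s) x S(s)^*, with S(s)^* = S(s^-1). *)
Definition conj_act (s : 'S_N) (x : E -> E) : E -> E := S s \o x \o S s^-1%g.

(* The regular representation of the crossed product on l^2(S_N, E):
   (x f)(s) = alpha_{s^-1}(x) f(s) and (g f)(s) = f(g^-1 s). *)
Definition cp_emb (x : E -> E) (f : {ffun 'S_N -> E}) : {ffun 'S_N -> E} :=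
  [ffun s => conj_act s^-1%g x (f s)].

Definition cp_shift (g : 'S_N) (f : {ffun 'S_N -> E}) : {ffun 'S_N -> E} :=
  [ffun s => f (g^-1 * s)%g].

Definition crossed_product (ip : E -> E -> R[i]) (M : set (E -> E)) :=
  vN_gen (l2_ip ip) ([set cp_emb x | x in M] `|` range cp_shift).

End CrossedProduct.

(* Main.v *)
(** The vectors fixed by [pi] on the pure braids form a [B_N]-invariant subspace
    on which [pi] factors through [S_N], so averaging over [S_N] gives
    [P_U = (N!)^-1 \sum_s S_s (x) pi(beta_s) p_pi] for any lifts [beta_s] of the
    permutations [s].  Thus [(A (x) B) P_U] corresponds in the crossed product to
    [(N!)^-1 \sum_s A s (x) B pi(beta_s) p_pi], and the trace of the crossed
    product only sees the term [s = 1], which is [A (x) B p_pi].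

    For positive [A] of infinite trace one first shows that positivity of
    [(A (x) B) P_U] forces [A] to be [alpha]-invariant and [C = B p_pi] to be a
    positive operator commuting with [pi]: comparing matrix entries over [S_N] with
    those of the adjoint gives [A (x) C pi_s = alpha_s(A) (x) pi_s C].  Then
    [x |-> (x (x) C) P_U] is monotone on [alpha]-invariant positive elements, and
    the infinite value follows by approximating [A] from below by [S_N]-averages of
    elements of finite trace. *)
Require Import Defs.
Set Warnings "-notation-overridden,-ambiguous-paths,-notation-incompatible-prefix".
From HB Require Import structures.
From mathcomp Require Import all_boot all_order all_algebra all_fingroup.
From mathcomp Require Import generic_quotient sesquilinear.
From mathcomp Require Import all_classical all_reals all_analysis.
From mathcomp Require Import complex ring zify.

Set Implicit Arguments.
Unset Strict Implicit.
Unset Printing Implicit Defensive.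

Import Order.TTheory GRing.Theory Num.Theory.
Import numFieldNormedType.Exports.

Local Open Scope classical_set_scope.
Local Open Scope ring_scope.

(** * Inner products *)

(** [Theta] is only given as a bijection respecting linear combinations, products and adjoints. So
    selfadjointness of [(A (x) B) P_U] is carried to the crossed product, whereas positivity of
    averages is proved there afresh from an explicit quadratic form. Selfadjointness suffices for
    comparing entries because operators on [l^2(S_N, K)] are block matrices in which the summands
    for different [s] fill different blocks; on [K] the operators [A S_s (x) B pi_s] are not
    separated in this way.

    Infinite traces need their own argument because a single summand is in general not positive:
    additivity on the positive cone does not apply to the sum, and linearity is available only
    inside the definition ideal. Membership in that ideal cannot be read off from [trace_ext], whose
    default value outside it is 0; polarization with the unitary shifts supplies it. A second
    polarization, in [End(V)], is needed because the product trace is prescribed on [x (x) b] for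
    positive [b] only. *)

Section LinearMaps.
Variables (F : pzRingType) (X Y : lmodType F) (f : X -> Y).
Hypothesis f_lin : linear f.

Lemma linD x y : f (x + y) = f x + f y.
Proof. by have := f_lin 1 x y; rewrite !scale1r. Qed.

Lemma lin0 : f 0 = 0.
Proof. by apply: (@addrI _ (f 0)); rewrite -linD !addr0. Qed.

Lemma linZ a x : f (a *: x) = a *: f x.
Proof. by have := f_lin a x 0; rewrite lin0 !addr0. Qed.

Lemma linN x : f (- x) = - f x.
Proof. by rewrite -scaleN1r linZ scaleN1r. Qed.

Lemma linB x y : f (x - y) = f x - f y.
Proof. by rewrite linD linN. Qed.

Lemma lin_sum I r (P : pred I) (g : I -> X) :
  f (\sum_(i <- r | P i) g i) = \sum_(i <- r | P i) f (g i).
Proof. exact: (big_morph f linD lin0). Qed.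

End LinearMaps.

Section InnerProduct.
Variable R : realType.
Local Notation C := R[i].

Definition inner_product (E : lmodType C) (ip : E -> E -> C) :=
  [/\ forall a x y z, ip (a *: x + y) z = a * ip x z + ip y z,
      forall x y, ip x y = (ip y x)^*,
      forall x, 0 <= ip x x &
      forall x, ip x x = 0 -> x = 0].

Lemma dot_inner_product (E : lmodType C) (d : {dot E for Num.conj}) :
  inner_product d.
Proof.
split=> [a x y z|x y|x|x xx].
- by rewrite linearDl linearZl_LR.
- by rewrite hermC /= expr0 mul1r.
- exact: dnorm_ge0.
- by apply/eqP; rewrite -(dnorm_eq0 d) xx.
Qed.

(** Complex polarization: the diagonal values at [x + y] and ['i *: x + y] give [f x y + f y x = 0]
    and [f x y = f y x]. *)
Lemma form_eq0 (E : lmodType C) (f : E -> E -> C) :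
  (forall a x y z, f (a *: x + y) z = a * f x z + f y z) ->
  (forall a x y z, f z (a *: x + y) = a^* * f z x + f z y) ->
  (forall x, f x x = 0) -> forall x y, f x y = 0.
Proof.
move=> fl fr f0 x y.
have e1 := f0 (1 *: x + y); have e2 := f0 ('i *: x + y).
move: e1 e2; rewrite !fl !fr !f0 !mulr0 !addr0 !add0r rmorph1 !mul1r.
rewrite conjCi mulNr => e1 e2.
have /(mulfI (neq0Ci C)) yx : 'i * f x y = 'i * f y x.
  by apply/eqP; rewrite -subr_eq0 e2.
by move: e1; rewrite -yx -mulr2n => /eqP; rewrite mulrn_eq0 /= => /eqP.
Qed.

Section Theory.
Variables (E : lmodType C) (ip : E -> E -> C).
Hypothesis ipP : inner_product ip.

Lemma ip_lin x : scalar (ip^~ x).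
Proof. by case: ipP => l _ _ _ a y z; rewrite /= l. Qed.

Lemma ipC x y : ip x y = (ip y x)^*.
Proof. by case: ipP => _ l _ _. Qed.

Lemma ip_ge0 x : 0 <= ip x x.
Proof. by case: ipP. Qed.

Lemma ip_eq0 x : ip x x = 0 -> x = 0.
Proof. by case: ipP => _ _ _; apply. Qed.

Lemma ipDl x y z : ip (x + y) z = ip x z + ip y z.
Proof. exact: linD (ip_lin z) x y. Qed.

Lemma ipZl a x z : ip (a *: x) z = a * ip x z.
Proof. exact: linZ (ip_lin z) a x. Qed.

Lemma ip0l z : ip 0 z = 0.
Proof. exact: lin0 (ip_lin z). Qed.

Lemma ipNl x z : ip (- x) z = - ip x z.
Proof. exact: linN (ip_lin z) x. Qed.

Lemma ipBl x y z : ip (x - y) z = ip x z - ip y z.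
Proof. exact: linB (ip_lin z) x y. Qed.

Lemma ip_suml I r (P : pred I) (g : I -> E) z :
  ip (\sum_(i <- r | P i) g i) z = \sum_(i <- r | P i) ip (g i) z.
Proof. exact: lin_sum (ip_lin z) _ _ _ _. Qed.

Lemma ipDr x y z : ip z (x + y) = ip z x + ip z y.
Proof. by rewrite ipC ipDl rmorphD /= -!ipC. Qed.

Lemma ipZr a x z : ip z (a *: x) = a^* * ip z x.
Proof. by rewrite ipC ipZl rmorphM /= -ipC. Qed.

Lemma ip0r z : ip z 0 = 0.
Proof. by rewrite ipC ip0l conjC0. Qed.

Lemma ipNr x z : ip z (- x) = - ip z x.
Proof. by rewrite ipC ipNl rmorphN /= -ipC. Qed.

Lemma ip_sumr I r (P : pred I) (g : I -> E) z :
  ip z (\sum_(i <- r | P i) g i) = \sum_(i <- r | P i) ip z (g i).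
Proof.
by rewrite ipC ip_suml rmorph_sum /=; apply: eq_bigr => i _; rewrite -ipC.
Qed.

Lemma ip_inj x y : (forall z, ip x z = ip y z) -> x = y.
Proof.
move=> xy; apply/eqP; rewrite -subr_eq0; apply/eqP/ip_eq0.
by rewrite ipBl xy subrr.
Qed.

(** Over complex scalars the quadratic form determines the operator: [form_eq0] applies to the form
    of [T - T']. This is how later equalities of operators follow from equalities of diagonal
    values. *)
Lemma op_ext (T T' : E -> E) : linear T -> linear T' ->
  (forall x, ip (T x) x = ip (T' x) x) -> T = T'.
Proof.
move=> Tl Tl' TT; apply/funext => x; apply: ip_inj => y.
apply/eqP; rewrite -subr_eq0 -ipBl; apply/eqP.
apply: (@form_eq0 E (fun x y => ip (T x - T' x) y)) => [a u v w|a u v w|u].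
- by rewrite Tl Tl' -ipZl -ipDl scalerBr opprD addrACA.
- by rewrite ipDr ipZr.
- by rewrite ipBl TT subrr.
Qed.

(** Since the diagonal values are real, the form [ip (T x) y - ip x (T y)] vanishes on the diagonal,
    hence everywhere. *)
Lemma positive_op_adjoint (T : E -> E) :
  linear T -> positive_op ip T -> adjoint ip T T.
Proof.
move=> Tl T0 x y; apply/eqP; rewrite -subr_eq0; apply/eqP.
apply: (@form_eq0 E (fun x y => ip (T x) y - ip x (T y))) => [a u v w|a u v w|u].
- by rewrite Tl !ipDl !ipZl mulrBr opprD addrACA.
- by rewrite Tl !ipDr !ipZr mulrBr opprD addrACA.
- by apply/eqP; rewrite subr_eq0 [X in _ == X]ipC eq_sym -CrealE ger0_real.
Qed.

Lemma adjoint_sym (T T' : E -> E) : adjoint ip T T' -> adjoint ip T' T.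
Proof. by move=> TT x y; rewrite ipC -TT -ipC. Qed.

Lemma ip_le_add x y : ip (x + y) (x + y) <= 2 * (ip x x + ip y y).
Proof.
have -> : 2 * (ip x x + ip y y) = ip (x + y) (x + y) + ip (x - y) (x - y).
  by rewrite !ipDr !ipDl !ipNr !ipNl opprK; ring.
by rewrite lerDl ip_ge0.
Qed.

End Theory.
End InnerProduct.

(** * Finite-dimensional inner product spaces *)

Section FiniteDimension.
Variables (R : realType) (V : vectType R[i]).
Local Notation C := R[i].

Lemma ntrace_linear (a : C) (b c : 'End(V)) :
  ntrace (a *: b + c) = a * ntrace b + ntrace c.
Proof.
by rewrite /ntrace passmx.mxof_linear linearD /= linearZ /= mulrDl mulrA.
Qed.

Lemma ntrace0 : ntrace (0 : 'End(V)) = 0.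
Proof.
have := ntrace_linear (-1) 0 0.
by rewrite scaler0 addr0 mulN1r addNr.
Qed.

Variable ip : V -> V -> C.
Hypothesis ipP : inner_product ip.

Definition orthonormal_basis n (e : 'I_n -> V) :=
  (forall i j, ip (e i) (e j) = (i == j)%:R) /\
  forall v, v = \sum_i ip v (e i) *: e i.

(** The operator [|v><w|]. *)
Definition rank1 (v w : V) : 'End(V) := linfun (fun x => ip x w *: v).

Lemma rank1E v w x : rank1 v w x = ip x w *: v.
Proof.
have lin : linear (fun x => ip x w *: v).
  by move=> a y z; rewrite (ip_lin ipP w) scalerDl scalerA.
pose f : {linear V -> V} := HB.pack (fun x => ip x w *: v)
  (GRing.isLinear.Build _ _ _ _ _ lin).
exact: (lfunE f x).
Qed.

(** The basis [vbasis] need not be orthonormal: its i-th diagonal entry is the i-th coordinate of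
    [v] times [ip b_i w], and these add up to [ip v w] by linearity. *)
Lemma ntrace_rank1 v w : ntrace (rank1 v w) = ip v w / (\dim {:V})%:R.
Proof.
rewrite /ntrace; congr (_ / _); rewrite /mxtrace.
rewrite [in RHS](coord_vbasis (memvf v)) (ip_suml ipP).
apply: eq_bigr => i _.
rewrite !mxE /= passmx.vecof_delta rank1E linearZ /= (ipZl ipP).
by rewrite mulrC.
Qed.

Lemma eigenvector_in (W : {vspace V}) (X : 'End(V)) :
  W != 0%VS -> (X @: W <= W)%VS ->
  exists v l, [/\ v \in W, v != 0 & X v = l *: v].
Proof.
move=> W0 XW; pose b := vbasis W.
have bW i : b`_i \in W.
  have [h|h] := ltnP i (size b); first exact/vbasis_mem/mem_nth.
  by rewrite nth_default ?mem0v.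
(* Row [i] holds the coordinates of [X b_i], so a row eigenvector of [A] lists the coordinates of an
   eigenvector of [X]; one exists because [R[i]] is algebraically closed. *)
pose A : 'M[C]_(\dim W) := \matrix_(i, j) coord b j (X b`_i).
have [l /eigenvalueP[u uA u0]] : exists l, eigenvalue A l.
  by apply: eigenvalue_closed; rewrite lt0n dimv_eq0.
exists (\sum_(i < \dim W) u 0 i *: b`_i), l; split.
- by apply: memv_suml => i _; apply/memvZ/bW.
- apply: contra u0 => /eqP s0; apply/eqP/rowP => j; rewrite mxE.
  have bf : free b by apply: basis_free; exact: vbasisP.
  by rewrite -(coord_sum_free (fun i : 'I_(\dim W) => u 0 i) j bf) s0 linear0.
- have XbE (i : 'I_(\dim W)) : X b`_i = \sum_j A i j *: b`_j.
    have XbW : X b`_i \in W by apply: (subvP XW); rewrite memv_img.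
    by rewrite [LHS](coord_vbasis XbW); apply: eq_bigr => j _; rewrite mxE.
  rewrite linear_sum scaler_sumr /=.
  under eq_bigr do rewrite linearZ /= XbE scaler_sumr.
  rewrite exchange_big /=; apply: eq_bigr => j _.
  have := congr1 (fun r : 'rV_(\dim W) => r 0 j) uA; rewrite !mxE.
  rewrite scalerA => <-; rewrite scaler_suml.
  by apply: eq_bigr => i _; rewrite scalerA.
Qed.

(** Spectral theorem, by induction on the dimension of an [X]-invariant subspace: split off a unit
    eigenvector; its orthogonal complement is again invariant because [X] is selfadjoint. *)
Lemma orthonormal_eigenbasis (X : 'End(V)) : adjoint ip X X ->
  exists n (e : 'I_n -> V) (l : 'I_n -> C),
    orthonormal_basis e /\ forall i, X (e i) = l i *: e i.
Proof.
move=> Xa.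
suff [n [e [l [eo es eX]]]] : exists n (e : 'I_n -> V) (l : 'I_n -> C),
    [/\ forall i j, ip (e i) (e j) = (i == j)%:R,
        forall v, v \in fullv -> v = \sum_i ip v (e i) *: e i &
        forall i, e i \in fullv /\ X (e i) = l i *: e i].
  exists n, e, l; split; last by move=> i; case: (eX i).
  by split=> // v; apply: es; rewrite memvf.
have: (X @: fullv <= fullv)%VS by exact: subvf.
have [m] := ubnP (\dim {:V}); move: (fullv : {vspace V}) => W.
elim: m W => // m IH W Wm XW.
have [->|W0] := eqVneq W 0%VS.
  exists 0, (fun=> 0), (fun=> 0); split=> [[]//|v|[]//].
  by rewrite memv0 big_ord0 => /eqP.
have [v0 [l0 [v0W v0n0 Xv0]]] := eigenvector_in W0 XW.
pose v := (sqrtC (ip v0 v0))^-1 *: v0.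
have ipv0 : 0 < ip v0 v0.
  rewrite lt_def (ip_ge0 ipP) andbT; apply: contra v0n0 => /eqP h.
  by apply/eqP/(ip_eq0 ipP).
have vW : v \in W by rewrite memvZ.
have vv : ip v v = 1.
  rewrite (ipZl ipP) (ipZr ipP) conj_Creal ?rpredV ?ger0_real ?sqrtC_ge0 ?ltW //.
  by rewrite mulrA -expr2 exprVn sqrtCK mulVf // gt_eqF.
have Xv : X v = l0 *: v by rewrite linearZ /= Xv0 !scalerA mulrC.
(* The orthogonal complement of [v] in [W], as [rank1 v v] sends [x] to [ip x v *: v]. *)
pose W' := (W :&: lker (rank1 v v))%VS.
have inW' x : (x \in W') = (x \in W) && (ip x v == 0).
  rewrite memv_cap memv_ker rank1E scaler_eq0; case: (eqVneq v 0) => [v0'|_].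
    by move: vv; rewrite v0' (ip0l ipP) => /eqP; rewrite eq_sym oner_eq0.
  by rewrite orbF.
have dW' : (\dim W' < m)%N.
  apply: (@leq_trans (\dim W)); last by rewrite -ltnS.
  have sW : (W' <= W)%VS by exact: capvSl.
  rewrite ltn_neqAle (dimvS sW) andbT; apply/eqP => dd.
  have /eqP e' : W' == W by rewrite eqEdim sW dd leqnn.
  by move: vW; rewrite -e' inW' vv oner_eq0 andbF.
have XW' : (X @: W' <= W')%VS.
  apply/subvP => _ /memv_imgP[x + ->]; rewrite !inW' => /andP[xW /eqP xv].
  apply/andP; split; first by apply: (subvP XW); rewrite memv_img.
  by rewrite Xa Xv (ipZr ipP) xv mulr0.
have [n [e [l [eo es eX]]]] := IH W' dW' XW'.
pose cons T (x : T) (f : 'I_n -> T) (i : 'I_n.+1) :=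
  if unlift ord0 i is Some j then f j else x.
have cons0 T (x : T) f : cons T x f ord0 = x by rewrite /cons unlift_none.
have consS T (x : T) f j : cons T x f (lift ord0 j) = f j by rewrite /cons liftK.
have eW i : e i \in W /\ ip (e i) v = 0.
  by have [] := eX i; rewrite inW' => /andP[? /eqP].
exists n.+1, (cons V v e), (cons C l0 l); split.
- move=> i j; case: (unliftP ord0 i) => [i' ->|->];
    case: (unliftP ord0 j) => [j' ->|->]; rewrite !(cons0, consS) //.
  + by rewrite (eW i').2.
  + by rewrite (ipC ipP) (eW j').2 conjC0.
- move=> w wW; rewrite big_ord_recl cons0.
  under eq_bigr do rewrite consS.
  have wW' : w - ip w v *: v \in W'.
    by rewrite inW' rpredB ?memvZ //= (ipBl ipP) (ipZl ipP) vv mulr1 subrr.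
  rewrite -[LHS](subrK (ip w v *: v)) [w - _ in LHS]es // addrC; congr (_ + _).
  apply: eq_bigr => i _; rewrite (ipBl ipP) (ipZl ipP).
  by rewrite (ipC ipP v) (eW i).2 conjC0 mulr0 subr0.
- move=> i; case: (unliftP ord0 i) => [i' ->|->]; rewrite !(cons0, consS) //.
  by split; [exact: (eW i').1 | exact: (eX i').2].
Qed.

(** An eigenbasis of the zero operator will do. *)
Lemma orthonormal_basis_exists : exists n (e : 'I_n -> V), orthonormal_basis e.
Proof.
have [|n [e [l [eo _]]]] := @orthonormal_eigenbasis 0; last by exists n, e.
by move=> x y; rewrite !lfunE /= (ip0l ipP) (ip0r ipP).
Qed.

(** Positive rank-one operators span [End(V)]. This extends to all [b] the trace formulas that are
    assumed for positive [b] only. *)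
Lemma rank1_ind (P : 'End(V) -> Prop) :
  P 0 -> (forall a b c, P b -> P c -> P (a *: b + c)) ->
  (forall v, P (rank1 v v)) -> forall b, P b.
Proof.
move=> P0 Pl P1 b; have [n [e [eo es]]] := orthonormal_basis_exists.
have PD b1 b2 : P b1 -> P b2 -> P (b1 + b2).
  by move=> h1 h2; rewrite -[b1]scale1r; apply: Pl.
have PZ a b1 : P b1 -> P (a *: b1) by move=> h; rewrite -[_ *: _]addr0; apply: Pl.
have P2 v w : P (rank1 v w).
  (* In the sum of [c *: q c] over the fourth roots of unity, [|v><w|] has coefficient [c * c^* = 1]
     each time, while the other terms carry [c] or [c ^+ 2] and cancel. *)
  pose q c := rank1 (v + c *: w) (v + c *: w).
  have -> : rank1 v w =
      4^-1 *: (q 1 + (- 1) *: q (- 1) + 'i *: q 'i + (- 'i) *: q (- 'i)).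
    apply/lfunP => x; rewrite rank1E; do ! rewrite lfunE /=; rewrite !rank1E.
    apply: (ip_inj ipP) => z.
    rewrite !(ipDr ipP, ipZr ipP, ipZl ipP, ipDl ipP) !rmorphN /= !conjCi rmorph1.
    have i2 := sqrCi C.
    by field: i2.
  have Pq c x : P (x *: q c) by exact/PZ/P1.
  rewrite -[q 1]scale1r; apply: PZ.
  exact: (PD _ _ (PD _ _ (PD _ _ (Pq _ _) (Pq _ _)) (Pq _ _)) (Pq _ _)).
rewrite (_ : b = \sum_i rank1 (b (e i)) (e i)).
  by elim/big_ind: _.
apply/lfunP => x; rewrite sum_lfunE {1}[x]es linear_sum /=.
by apply: eq_bigr => i _; rewrite rank1E linearZ.
Qed.

End FiniteDimension.

(** * Bounded operators and algebras of operators *)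

Section BoundedMaps.
Variable R : realType.
Local Notation C := R[i].

Lemma zeroE (T : Type) (F : nmodType) (x : T) : (0 : T -> F) x = 0.
Proof. by []. Qed.

Definition bounded_map (E F : lmodType C) (ipE : E -> E -> C) (ipF : F -> F -> C)
    (T : E -> F) :=
  linear T /\ exists2 k, 0 <= k & forall x, ipF (T x) (T x) <= k * ipE x x.

(** The constant in [bounded_op] is any complex number. A nonzero vector forces it to be
    nonnegative; on the zero space it is arbitrary, hence the passage to its modulus. *)
Lemma bounded_opE (E : lmodType C) (ip : E -> E -> C) (T : E -> E) :
  inner_product ip -> bounded_op ip T <-> bounded_map ip ip T.
Proof.
move=> ipP; split=> [[Tl [k Tk]]|[Tl [k _ Tk]]]; split=> //; last by exists k.
exists `|k| => // x; have := ip_ge0 ipP x; rewrite le_eqVlt => /predU1P[x0|x0].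
  by rewrite -x0 mulr0 (ip_eq0 ipP (esym x0)) (lin0 Tl) (ip0l ipP).
suff k0 : 0 <= k by rewrite ger0_norm.
rewrite -(pmulr_lge0 _ x0) (le_trans _ (Tk x)) //.
exact: ip_ge0.
Qed.

Section Closure.
Variables (E F G : lmodType C) (ipE : E -> E -> C) (ipF : F -> F -> C).
Variable ipG : G -> G -> C.
Hypotheses (ipEP : inner_product ipE) (ipFP : inner_product ipF).

Lemma bounded_map0 : bounded_map ipE ipF 0.
Proof.
split=> [a x y|]; first by rewrite zeroE scaler0 addr0.
by exists 0 => // x; rewrite zeroE (ip0l ipFP) mul0r.
Qed.

Lemma bounded_mapD (T T' : E -> F) :
  bounded_map ipE ipF T -> bounded_map ipE ipF T' -> bounded_map ipE ipF (T + T').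
Proof.
move=> [Tl [k k0 Tk]] [Tl' [k' k0' Tk']]; split=> [a x y|].
  by rewrite !fctE Tl Tl' scalerDr addrACA.
exists (2 * (k + k')) => [|x]; first by rewrite mulr_ge0 ?addr_ge0.
apply: le_trans (ip_le_add ipFP _ _) _.
by rewrite -mulrA ler_pM2l ?ltr0n // mulrDl lerD.
Qed.

Lemma bounded_mapZ (c : C) (T : E -> F) :
  bounded_map ipE ipF T -> bounded_map ipE ipF (c *: T).
Proof.
move=> [Tl [k k0 Tk]]; split=> [a x y|].
  by rewrite !fctE Tl scalerDr !scalerA mulrC.
exists (`|c| ^+ 2 * k) => [|x]; first by rewrite mulr_ge0 ?exprn_ge0.
by rewrite !fctE (ipZl ipFP) (ipZr ipFP) mulrA -normCK -[leRHS]mulrA ler_wpM2l ?exprn_ge0.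
Qed.

Lemma bounded_map_sum I r (P : pred I) (T : I -> E -> F) :
  (forall i, P i -> bounded_map ipE ipF (T i)) ->
  bounded_map ipE ipF (\sum_(i <- r | P i) T i).
Proof.
by move=> TP; elim/big_ind: _ => //; [exact: bounded_map0 | exact: bounded_mapD].
Qed.

Lemma bounded_map_comp (T : E -> F) (T' : F -> G) :
  bounded_map ipE ipF T -> bounded_map ipF ipG T' -> bounded_map ipE ipG (T' \o T).
Proof.
move=> [Tl [k k0 Tk]] [Tl' [k' k0' Tk']]; split=> [a x y|].
  by rewrite !fctE Tl Tl'.
exists (k' * k) => [|x]; first by rewrite mulr_ge0.
by rewrite (le_trans (Tk' _)) // -mulrA ler_wpM2l.
Qed.

Lemma isometry_bounded (T : E -> F) : linear T ->
  (forall x, ipF (T x) (T x) = ipE x x) -> bounded_map ipE ipF T.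
Proof. by move=> Tl TE; split=> //; exists 1 => // x; rewrite TE mul1r. Qed.

End Closure.

Section Commutant.
Variables (E : lmodType C) (ip : E -> E -> C) (S : set (E -> E)).
Hypothesis ipP : inner_product ip.
Local Notation M := (commutant ip S).
Implicit Types T : E -> E.

Lemma commutant_linear T : M T -> linear T.
Proof. by case=> -[]. Qed.

Lemma commutant_bounded T : M T -> bounded_op ip T.
Proof. by case. Qed.

Hypothesis S_lin : forall T, S T -> linear T.

Lemma commutant0 : M 0.
Proof.
split; first by apply/(bounded_opE _ ipP)/bounded_map0.
by move=> X /S_lin Xl; apply/funext => x; rewrite !fctE !zeroE (lin0 Xl).
Qed.

Lemma commutant1 : M id.
Proof.
split=> //; apply/(bounded_opE _ ipP)/isometry_bounded => //.
Qed.

Lemma commutantD T T' : M T -> M T' -> M (T + T').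
Proof.
move=> [Tb Tc] [Tb' Tc']; split=> [|X SX].
  by apply/(bounded_opE _ ipP)/bounded_mapD => //; apply/(bounded_opE _ ipP).
apply/funext => x; rewrite !fctE (linD (S_lin SX)).
by congr (_ + _); [move/funeqP: (Tc X SX); apply | move/funeqP: (Tc' X SX); apply].
Qed.

Lemma commutantZ c T : M T -> M (c *: T).
Proof.
move=> [Tb Tc]; split=> [|X SX].
  by apply/(bounded_opE _ ipP)/bounded_mapZ => //; apply/(bounded_opE _ ipP).
apply/funext => x; rewrite !fctE (linZ (S_lin SX)).
by congr (_ *: _); move/funeqP: (Tc X SX); apply.
Qed.

Lemma commutant_sum I r (P : pred I) (T : I -> E -> E) :
  (forall i, P i -> M (T i)) -> M (\sum_(i <- r | P i) T i).
Proof.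
by move=> TP; elim/big_ind: _ => //; [exact: commutant0 | exact: commutantD].
Qed.

Lemma commutant_comp T T' : M T -> M T' -> M (T \o T').
Proof.
move=> [Tb Tc] [Tb' Tc']; split=> [|X SX].
  by apply/(bounded_opE _ ipP)/(bounded_map_comp (ipF := ip)); apply/(bounded_opE _ ipP).
by rewrite -compA Tc' // compA Tc // compA.
Qed.

End Commutant.

(** The common form of [M], [Q_U], the crossed product and its tensor product with [End(V)], all of
    them bicommutants; boundedness and closure under the algebra operations follow at once for
    each. *)
Definition operator_algebra (E : lmodType C) (ip : E -> E -> C) (M : set (E -> E)) :=
  exists2 S : set (E -> E), (forall T, S T -> linear T) & M = commutant ip S.

Section OperatorAlgebra.
Variables (E : lmodType C) (ip : E -> E -> C) (M : set (E -> E)).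
Hypotheses (ipP : inner_product ip) (M_alg : operator_algebra ip M).
Implicit Types T : E -> E.

Lemma vN_gen_alg S : operator_algebra ip (vN_gen ip S).
Proof. by exists (commutant ip S) => // T; exact: commutant_linear. Qed.

Lemma alg_linear T : M T -> linear T.
Proof. by case: M_alg => S _ ->; exact: commutant_linear. Qed.

Lemma alg_bounded T : M T -> bounded_op ip T.
Proof. by case: M_alg => S _ ->; exact: commutant_bounded. Qed.

Lemma alg0 : M 0.
Proof. by case: M_alg => S Sl ->; exact: commutant0. Qed.

Lemma alg1 : M id.
Proof. by case: M_alg => S Sl ->; exact: commutant1. Qed.

Lemma algD T T' : M T -> M T' -> M (T + T').
Proof. by case: M_alg => S Sl ->; exact: commutantD. Qed.

Lemma algZ c T : M T -> M (c *: T).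
Proof. by case: M_alg => S Sl ->; exact: commutantZ. Qed.

Lemma algB T T' : M T -> M T' -> M (T - T').
Proof. by move=> MT MT'; rewrite -[- T']scaleN1r; exact/algD/algZ. Qed.

Lemma alg_sum I r (P : pred I) (T : I -> E -> E) :
  (forall i, P i -> M (T i)) -> M (\sum_(i <- r | P i) T i).
Proof. by case: M_alg => S Sl ->; exact: commutant_sum. Qed.

Lemma alg_comp T T' : M T -> M T' -> M (T \o T').
Proof. by case: M_alg => S Sl ->; exact: commutant_comp. Qed.

End OperatorAlgebra.

Lemma sub_vN_gen (E : lmodType C) (ip : E -> E -> C) (S : set (E -> E)) T :
  S T -> bounded_op ip T -> vN_gen ip S T.
Proof. by move=> ST Tb; split=> // X [_ XS]; rewrite XS. Qed.

End BoundedMaps.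

(** * Tensor products with a finite-dimensional space *)

Section HilbertTensor.
Variable R : realType.
Local Notation C := R[i].
Variables (E : lmodType C) (V : vectType C) (K : lmodType C).
Variables (ipE : E -> E -> C) (ipV : V -> V -> C) (ipK : K -> K -> C).
Variable t : E -> V -> K.
Hypotheses (ipEP : inner_product ipE) (ipVP : inner_product ipV).
Hypotheses (ipKP : inner_product ipK) (tP : hilbert_tensor ipE ipV ipK t).

Let t_linl v : linear (t^~ v). Proof. by case: tP. Qed.
Let t_linr xi : linear (t xi). Proof. by case: tP. Qed.
Let t_ip xi eta v w : ipK (t xi v) (t eta w) = ipE xi eta * ipV v w.
Proof. by case: tP. Qed.

Lemma tensor_ext (L : lmodType C) (X Y : K -> L) : linear X -> linear Y ->
  (forall xi v, X (t xi v) = Y (t xi v)) -> X = Y.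
Proof.
move=> Xl Yl XY; apply/funext => f; case: tP => _ _ _ /(_ f)[n [xi [v ->]]].
by rewrite (lin_sum Xl) (lin_sum Yl); apply: eq_bigr.
Qed.

Lemma tensor_ip_ext f g : (forall xi v, ipK f (t xi v) = ipK g (t xi v)) -> f = g.
Proof.
move=> fg; apply: (ip_inj ipKP) => h; case: tP => _ _ _ /(_ h)[n [xi [v ->]]].
by rewrite !(ip_sumr ipKP); apply: eq_bigr.
Qed.

Lemma tensor_adjoint_ext (X Y : K -> K) : linear X -> linear Y ->
  (forall xi v eta w,
     ipK (X (t xi v)) (t eta w) = ipK (t xi v) (Y (t eta w))) ->
  adjoint ipK X Y.
Proof.
move=> Xl Yl XY f g.
case: tP => _ _ _ tf; have [n [xi [v ->]]] := tf f; have [m [eta [w ->]]] := tf g.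
rewrite (lin_sum Xl) (lin_sum Yl) !(ip_suml ipKP); apply: eq_bigr => i _.
by rewrite !(ip_sumr ipKP); apply: eq_bigr.
Qed.

Lemma tensor_bounded v : bounded_map ipE ipK (t^~ v).
Proof.
split; first exact: t_linl.
by exists (ipV v v) => [|xi]; rewrite ?(ip_ge0 ipVP) // t_ip mulrC.
Qed.

Section Slices.
Variables (n : nat) (e : 'I_n -> V).
Hypothesis eP : orthonormal_basis ipV e.

Lemma tensor_slices_exist f : exists xi : 'I_n -> E, f = \sum_i t (xi i) (e i).
Proof.
case: tP => _ _ _ /(_ f)[m [xi [v ->]]].
exists (fun i => \sum_k ipV (v k) (e i) *: xi k).
under [RHS]eq_bigr do rewrite (lin_sum (t_linl _)).
rewrite exchange_big; apply: eq_bigr => k _ /=.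
rewrite {1}[v k]eP.2 (lin_sum (t_linr _)); apply: eq_bigr => i _.
by rewrite (linZ (t_linr _)) (linZ (t_linl _)).
Qed.

Definition slice (i : 'I_n) (f : K) : E := sval (cid (tensor_slices_exist f)) i.

Lemma sliceE f : f = \sum_i t (slice i f) (e i).
Proof. exact: svalP (cid (tensor_slices_exist f)). Qed.

(** Says that [slice i] is the adjoint of [t^~ (e i)]. This pins down the slices obtained by choice
    and makes them linear. *)
Lemma slice_ip i f xi : ipE (slice i f) xi = ipK f (t xi (e i)).
Proof.
rewrite {2}[f]sliceE (ip_suml ipKP) (bigD1 i) //= t_ip eP.1 eqxx mulr1.
rewrite big1 ?addr0 // => j /negPf ji.
by rewrite t_ip eP.1 ji mulr0.
Qed.

Lemma slice_linear i : linear (slice i).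
Proof.
move=> a f g; apply: (ip_inj ipEP) => xi.
by rewrite (ip_lin ipEP) !slice_ip (ip_lin ipKP).
Qed.

Lemma tensor_normE f : ipK f f = \sum_i ipE (slice i f) (slice i f).
Proof.
rewrite {2}[f]sliceE (ip_sumr ipKP).
by apply: eq_bigr => i _; rewrite slice_ip.
Qed.

Lemma slice_bounded i : bounded_map ipK ipE (slice i).
Proof.
split; first exact: slice_linear.
exists 1 => // f; rewrite mul1r tensor_normE (bigD1 i) //= lerDl.
by apply: sumr_ge0 => j _; exact: ip_ge0.
Qed.

End Slices.

(** Guarantees that the [xget] in [tens_op] does not fall back on its default [id]. In coordinates,
    the sum of the [t (xi i) (e i)] goes to the sum of the [t (a (xi i)) (b (e i))]. *)
Lemma tens_op_exists a (b : 'End(V)) : bounded_op ipE a ->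
  exists T : K -> K, bounded_op ipK T /\ forall xi v, T (t xi v) = t (a xi) (b v).
Proof.
move=> ab; have [n [e eP]] := orthonormal_basis_exists ipVP.
exists (\sum_i (t^~ (b (e i)) \o a \o slice eP i)); split=> [|xi v].
  apply/(bounded_opE _ ipKP)/bounded_map_sum => // i _.
  apply: (bounded_map_comp (slice_bounded eP i)).
  apply: (@bounded_map_comp _ _ _ _ _ ipE _ a); last exact: tensor_bounded.
  exact/(bounded_opE _ ipEP).
have al := ab.1.
have sl i : slice eP i (t xi v) = ipV v (e i) *: xi.
  by apply: (ip_inj ipEP) => eta; rewrite slice_ip t_ip (ipZl ipEP) mulrC.
rewrite fct_sumE {2}[v]eP.2 linear_sum (lin_sum (t_linr _)); apply: eq_bigr => i _ /=.
by rewrite sl (linZ al) (linZ (t_linl _)) linearZ (linZ (t_linr _)).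
Qed.

Local Notation tens := (tens_op ipK t).

Section TensOp.
Variables (a : E -> E) (b : 'End(V)).
Hypothesis a_bounded : bounded_op ipE a.

Lemma tens_opP : bounded_op ipK (tens a b) /\
  forall xi v, tens a b (t xi v) = t (a xi) (b v).
Proof.
rewrite /tens_op; case: xgetP => [T _ //|/= no].
by have [T TP] := tens_op_exists b a_bounded; case: (no T).
Qed.

Lemma tens_bounded : bounded_op ipK (tens a b). Proof. by case: tens_opP. Qed.

Lemma tens_linear : linear (tens a b). Proof. by case: tens_bounded. Qed.

Lemma tensE xi v : tens a b (t xi v) = t (a xi) (b v).
Proof. by case: tens_opP. Qed.

Lemma tens_uniq X : linear X -> (forall xi v, X (t xi v) = t (a xi) (b v)) ->
  tens a b = X.
Proof.
by move=> Xl XE; apply: (tensor_ext tens_linear Xl) => xi v; rewrite tensE.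
Qed.

End TensOp.

Lemma tens1 : tens id \1%VF = id.
Proof.
have ib : bounded_op ipE id by apply/(bounded_opE _ ipEP)/isometry_bounded.
by apply: (tens_uniq ib) => // xi v; rewrite lfunE.
Qed.

Lemma tens_comp a a' (b b' : 'End(V)) : bounded_op ipE a -> bounded_op ipE a' ->
  tens a b \o tens a' b' = tens (a \o a') (b \o b')%VF.
Proof.
move=> ab ab'; apply/esym/tens_uniq.
- apply/(bounded_opE _ ipEP)/(bounded_map_comp (ipF := ipE));
    exact/(bounded_opE _ ipEP).
- by move=> c f g; rewrite !fctE (tens_linear b' ab') (tens_linear b ab).
- by move=> xi v; rewrite !fctE !tensE // lfunE.
Qed.

Lemma tens_linl c a a' (b : 'End(V)) : bounded_op ipE a -> bounded_op ipE a' ->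
  tens (c *: a + a') b = c *: tens a b + tens a' b.
Proof.
move=> ab ab'; apply: tens_uniq.
- apply/(bounded_opE _ ipEP)/bounded_mapD => //; last exact/(bounded_opE _ ipEP).
  by apply/bounded_mapZ => //; exact/(bounded_opE _ ipEP).
- apply: (bounded_mapD ipKP _ _).1; last exact/(bounded_opE _ ipKP)/tens_bounded.
  by apply/bounded_mapZ => //; exact/(bounded_opE _ ipKP)/tens_bounded.
- by move=> xi v; rewrite !fctE !tensE // t_linl.
Qed.

Lemma tens_linr c a (b b' : 'End(V)) : bounded_op ipE a ->
  tens a (c *: b + b') = c *: tens a b + tens a b'.
Proof.
move=> ab; apply: tens_uniq => //.
- apply: (bounded_mapD ipKP _ _).1; last exact/(bounded_opE _ ipKP)/tens_bounded.
  by apply/bounded_mapZ => //; exact/(bounded_opE _ ipKP)/tens_bounded.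
- by move=> xi v; rewrite !fctE !tensE // lfunE /= lfunE t_linr.
Qed.

Lemma tens0r a : bounded_op ipE a -> tens a 0 = 0.
Proof.
move=> ab; have := tens_linr (-1) (0 : 'End(V)) 0 ab.
by rewrite scaler0 addr0 scaleN1r addNr.
Qed.

Lemma tens_adjoint a a' (b b' : 'End(V)) : bounded_op ipE a -> bounded_op ipE a' ->
  adjoint ipE a a' -> adjoint ipV b b' -> adjoint ipK (tens a b) (tens a' b').
Proof.
move=> ab ab' aa bb.
apply: tensor_adjoint_ext; [exact: tens_linear | exact: tens_linear |].
by move=> xi v eta w; rewrite !tensE // !t_ip aa bb.
Qed.

Lemma tens_rank1_positive a v : bounded_op ipE a -> positive_op ipE a ->
  positive_op ipK (tens a (rank1 ipV v v)).
Proof.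
move=> ab a0 f; have [n [e eP]] := orthonormal_basis_exists ipVP.
(* The contraction of [f] against [v]: it sends [t xi w] to [ipV w v *: xi]. *)
pose eta := \sum_i ipV (e i) v *: slice eP i f.
suff -> : ipK (tens a (rank1 ipV v v) f) f = ipE (a eta) eta by exact: a0.
rewrite {1 2}[f](sliceE eP) (lin_sum (tens_linear _ ab)) (lin_sum ab.1).
rewrite (ip_suml ipKP) (ip_suml ipEP); apply: eq_bigr => i _.
rewrite (ip_sumr ipKP) (ip_sumr ipEP); apply: eq_bigr => j _.
rewrite tensE // t_ip (rank1E ipVP) (linZ ab.1) (ipZl ipVP) (ipZl ipEP) (ipZr ipEP).
by rewrite -(ipC ipVP) mulrC -!mulrA; congr (_ * _); rewrite mulrC.
Qed.

(** The spectral decomposition of [b] writes it as a nonnegative combination of operators [|e><e|],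
    for which [a (x) b] is positive by contraction. *)
Lemma tens_positive a (b : 'End(V)) : bounded_op ipE a -> positive_op ipE a ->
  positive_op ipV b -> positive_op ipK (tens a b).
Proof.
move=> ab a0 b0; have bl : linear b by exact: linearP.
have [n [e [l [eP be]]]] :=
  orthonormal_eigenbasis ipVP (positive_op_adjoint ipVP bl b0).
have -> : b = \sum_i l i *: rank1 ipV (e i) (e i).
  apply/lfunP => x; rewrite {1}[x]eP.2 linear_sum sum_lfunE; apply: eq_bigr => i _.
  by rewrite lfunE /= (rank1E ipVP) linearZ /= be !scalerA mulrC.
have l0 i : 0 <= l i.
  by have := b0 (e i); rewrite be (ipZl ipVP) eP.1 eqxx mulr1.
pose Q (c : 'End(V)) := positive_op ipK (tens a c).
apply: (big_ind Q) => [|c c' Qc Qc'|i _] f.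
- by rewrite (tens0r ab) (ip0l ipKP).
- by rewrite -[c]scale1r tens_linr // scale1r (ipDl ipKP) addr_ge0 ?Qc ?Qc'.
- rewrite -[_ *: _]addr0 tens_linr // tens0r // addr0 (ipZl ipKP).
  by rewrite mulr_ge0 ?l0 //; exact: tens_rank1_positive.
Qed.

End HilbertTensor.

(** * Traces *)

Definition finite_positive (R : realType) (E : lmodType R[i]) (ip : E -> E -> R[i])
    (M : set (E -> E)) (tau : (E -> E) -> \bar R) (x : E -> E) :=
  positive_cone ip M x /\ (tau x < +oo)%E.

Section Traces.
Variable R : realType.
Local Notation C := R[i].
Variables (E : lmodType C) (ip : E -> E -> C) (M : set (E -> E)).
Variable tau : (E -> E) -> \bar R.
Hypotheses (ipP : inner_product ip) (M_alg : operator_algebra ip M).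
Hypothesis tauP : fns_trace ip M tau.
Implicit Types x y : E -> E.

Local Notation cone := (positive_cone ip M).
Local Notation fin := (finite_positive ip M tau).
Local Notation tr x := ((fine (tau x%R))%:C)%C.
Local Notation trace_val := (trace_val ip M tau).

Lemma positive_cone0 : cone 0.
Proof.
by split; [apply: (alg0 ipP M_alg) | move=> f; rewrite zeroE (ip0l ipP)].
Qed.

Lemma positive_coneD x y : cone x -> cone y -> cone (x + y).
Proof.
move=> [Mx x0] [My y0]; split; first exact: (algD ipP M_alg).
by move=> f; rewrite !fctE (ipDl ipP) addr_ge0.
Qed.

Lemma positive_coneZ (c : C) x : 0 <= c -> cone x -> cone (c *: x).
Proof.
move=> c0 [Mx x0]; split; first exact: (algZ ipP M_alg).
by move=> f; rewrite !fctE (ipZl ipP) mulr_ge0.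
Qed.

Lemma trace_ge0 x : cone x -> (0 <= tau x)%E.
Proof. by case: tauP => -[h *]; exact: h. Qed.

Lemma traceD x y : cone x -> cone y -> tau (x + y) = (tau x + tau y)%E.
Proof. by case: tauP => -[? h *]; exact: h. Qed.

Lemma traceZ (c : R) x : 0 <= c -> cone x -> tau (c%:C%C *: x) = (c%:E * tau x)%E.
Proof. by case: tauP => -[? ? h *]; exact: h. Qed.

Lemma trace_conj u u' x : M u -> M u' -> adjoint ip u u' ->
  u \o u' = id -> u' \o u = id -> cone x -> tau (u \o x \o u') = tau x.
Proof. by case: tauP => -[? ? ? h] *; exact: h. Qed.

Lemma trace0 : tau 0 = 0%E.
Proof.
have := traceZ (lexx 0) positive_cone0.
by rewrite scaler0 mul0e.
Qed.

Lemma trace_fineK x : fin x -> tau x = (fine (tau x))%:E.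
Proof.
move=> [cx xf]; rewrite fineK // fin_numE -ltNye (lt_le_trans _ (trace_ge0 cx)) //=.
by rewrite lt_eqF.
Qed.

Lemma trace_mono x y : cone x -> cone y -> (tau x <= tau (x + y)%R)%E.
Proof. by move=> cx cy; rewrite traceD // leeDl // trace_ge0. Qed.

Lemma fin_trace0 : fin 0.
Proof. by split; [exact: positive_cone0 | rewrite trace0 ltry]. Qed.

Lemma fin_traceD x y : fin x -> fin y -> fin (x + y) /\ tr (x + y) = tr x + tr y.
Proof.
move=> fx fy; have e := traceD fx.1 fy.1.
rewrite (trace_fineK fx) (trace_fineK fy) -EFinD in e.
split; last by rewrite e /= rmorphD.
by split; [apply: positive_coneD; [exact: fx.1|exact: fy.1] | rewrite e ltry].
Qed.

Lemma fin_traceZ (c : R) x : 0 <= c -> fin x ->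
  fin (c%:C%C *: x) /\ tr (c%:C%C *: x) = c%:C%C * tr x.
Proof.
move=> c0 fx; have e := traceZ c0 fx.1.
rewrite (trace_fineK fx) -EFinM in e.
split; last by rewrite e /= rmorphM.
split; last by rewrite e ltry.
by apply: positive_coneZ; [rewrite ler0c | exact: fx.1].
Qed.

Lemma trace_val_alg x z : trace_val x z -> M x.
Proof.
move=> [a [b [c [d [[[[Ma _] _] [[Mb _] _] [[Mc _] _] [[Md _] _]] [-> _]]]]]].
apply: (algD ipP M_alg); first exact: (algB ipP M_alg).
exact/(algZ ipP M_alg _)/(algB ipP M_alg).
Qed.

Lemma trace_val_fin x : fin x -> trace_val x (tr x).
Proof.
move=> fx; exists x, 0, 0, 0; split; first by split=> //; exact: fin_trace0.
by rewrite trace0 /= !subr0 scaler0 mulr0 !addr0.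
Qed.

Lemma trace_valD x y z w : trace_val x z -> trace_val y w -> trace_val (x + y) (z + w).
Proof.
move=> [a [b [c [d [[fa fb fc fd] [-> ->]]]]]].
move=> [a' [b' [c' [d' [[fa' fb' fc' fd'] [-> ->]]]]]].
have [fA eA] := fin_traceD fa fa'; have [fB eB] := fin_traceD fb fb'.
have [fC eC] := fin_traceD fc fc'; have [fD eD] := fin_traceD fd fd'.
exists (a + a'), (b + b'), (c + c'), (d + d'); split=> //.
rewrite eA eB eC eD; split; last by ring.
apply/funext => f; rewrite !fctE.
rewrite addrACA -scalerDr; congr (_ + 'i *: _); rewrite opprD addrACA //.
Qed.

Lemma trace_valN x z : trace_val x z -> trace_val (- x) (- z).
Proof.
move=> [a [b [c [d [[fa fb fc fd] [-> ->]]]]]].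
exists b, a, d, c; split=> //; split; last by ring.
by rewrite opprD -scalerN !opprB.
Qed.

Lemma trace_valZi x z : trace_val x z -> trace_val ('i *: x) ('i * z).
Proof.
move=> [a [b [c [d [[fa fb fc fd] [-> ->]]]]]].
exists d, c, a, b; split=> //; split.
  by rewrite scalerDr scalerA -expr2 sqrCi scaleN1r opprB addrC.
by rewrite mulrDr mulrA -expr2 sqrCi mulN1r opprB addrC.
Qed.

Lemma trace_valZr (r : R) x z : trace_val x z -> trace_val (r%:C%C *: x) (r%:C%C * z).
Proof.
wlog r0 : r / 0 <= r => [wl tx|].
  have [/wl|r0] := leP 0 r; first exact.
  have := trace_valN (wl (- r) _ tx); rewrite oppr_ge0 => /(_ (ltW r0)).
  by rewrite rmorphN /= scaleNr mulNr !opprK.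
move=> [a [b [c [d [[fa fb fc fd] [-> ->]]]]]].
have [fA eA] := fin_traceZ r0 fa; have [fB eB] := fin_traceZ r0 fb.
have [fC eC] := fin_traceZ r0 fc; have [fD eD] := fin_traceZ r0 fd.
exists (r%:C%C *: a), (r%:C%C *: b), (r%:C%C *: c), (r%:C%C *: d); split=> //.
rewrite eA eB eC eD; split; last by ring.
by rewrite scalerDr scalerA mulrC -scalerA !scalerBr.
Qed.

Lemma trace_valZ (c : C) x z : trace_val x z -> trace_val (c *: x) (c * z).
Proof.
move=> tx; rewrite [c]complexE complexiE scalerDl mulrDl -scalerA -mulrA.
by apply: trace_valD; [exact: trace_valZr | exact/trace_valZi/trace_valZr].
Qed.

Lemma trace_val_sum I r (P : pred I) (x : I -> E -> E) (z : I -> C) :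
  (forall i, P i -> trace_val (x i) (z i)) ->
  trace_val (\sum_(i <- r | P i) x i) (\sum_(i <- r | P i) z i).
Proof.
move=> xz; elim/big_rec2: _ => [|i w y Pi yw]; last exact/trace_valD/yw/xz.
by have := trace_val_fin fin_trace0; rewrite trace0.
Qed.

Lemma cone_real x f : cone x -> ip (x f) f \is Num.real.
Proof. by move=> [_ x0]; rewrite ger0_real. Qed.

(** Makes [trace_val] single-valued. If [x = a - b + 'i *: (c - d)] is positive, the imaginary part
    of its quadratic form gives [c = d] and the real part gives [x + b = a]; so [tau x <= tau a],
    and additivity of [tau] yields the value. *)
Lemma trace_val_positive x z : positive_op ip x -> trace_val x z ->
  fin x /\ z = tr x.
Proof.
move=> x0 xz; have Mx := trace_val_alg xz; have cx : cone x by [].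
move: xz => [a [b [c [d [[fa fb fc fd] [xE zE]]]]]].
have eq_re f : ip (x f) f = ip (a f) f - ip (b f) f.
  have := congr1 (fun z : C => 'Re z) (congr1 (fun y => ip (y f) f) xE).
  rewrite !fctE (ipDl ipP) (ipZl ipP) !(ipBl ipP).
  have rl y : fin y -> ip (y f) f \is Num.real by move=> fy; apply: cone_real fy.1.
  by rewrite Re_rect ?rpredB ?rl // (Creal_ReP _ _) // cone_real.
have eq_im f : ip (c f) f = ip (d f) f.
  have := congr1 (fun y => ip (y f) f) xE.
  rewrite !fctE (ipDl ipP) (ipZl ipP) !(ipBl ipP) -eq_re -{1}[ip (x f) f]addr0.
  move=> /addrI/esym/eqP; rewrite mulf_eq0 (negPf (neq0Ci C)) /= subr_eq0.
  by move/eqP.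
have Ml y : M y -> linear y by exact: (alg_linear M_alg).
have cd : c = d.
  by apply: (op_ext ipP) => //; apply: Ml; [exact: fc.1.1 | exact: fd.1.1].
have xb : x + b = a.
  apply: (op_ext ipP) => [||f]; first by apply/Ml/(algD ipP M_alg) => //; exact: fb.1.1.
    by apply: Ml; exact: fa.1.1.
  by rewrite !fctE (ipDl ipP) eq_re subrK.
have fx : fin x.
  split=> //; apply: le_lt_trans fa.2; rewrite -xb.
  by apply: trace_mono => //; exact: fb.1.
split=> //; have [_ e] := fin_traceD fx fb.
by rewrite zE cd -xb e addrK subrr mulr0 addr0.
Qed.

(** The difference of two values at [x] is a value at the positive operator 0. *)
Lemma trace_val_uniq x z w : trace_val x z -> trace_val x w -> z = w.
Proof.
move=> xz xw; apply/eqP; rewrite -subr_eq0.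
have := trace_valD xz (trace_valN xw); rewrite subrr => e.
have p0 : positive_op ip 0 := positive_cone0.2.
by have [_ ->] := trace_val_positive p0 e; rewrite trace0.
Qed.

Lemma trace_val_ext x z : trace_val x z -> trace_ext ip M tau x = z.
Proof.
move=> xz; rewrite /trace_ext; case: xgetP => [w _ xw|/(_ z)//].
exact: trace_val_uniq xw xz.
Qed.

Lemma trace_idealP x : trace_ideal ip M tau x -> trace_val x (trace_ext ip M tau x).
Proof. by move=> [z xz]; rewrite (trace_val_ext xz). Qed.

(* [4 x u] is the combination of [(1 + c u)^* x (1 + c u)], [c^4 = 1], with
   coefficients [c^*]; the parallelogram identity bounds their traces. *)
Lemma trace_ideal_unitary x u u' : fin x -> M u -> M u' -> adjoint ip u u' ->
  u \o u' = id -> u' \o u = id -> trace_ideal ip M tau (x \o u).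
Proof.
move=> fx Mu Mu' uu' uK u'K; have [Mx x0] := fx.1.
have xl := alg_linear M_alg Mx; have u'l := alg_linear M_alg Mu'.
pose w (c : C) := id + c *: u; pose w' (c : C) := id + c^* *: u'.
have Mw c : M (w c).
  by apply: (algD ipP M_alg); [exact: (alg1 ipP M_alg) | exact: (algZ ipP M_alg)].
have Mw' c : M (w' c).
  by apply: (algD ipP M_alg); [exact: (alg1 ipP M_alg) | exact: (algZ ipP M_alg)].
pose y c := w' c \o x \o w c.
have cy c : cone (y c).
  split=> [|f]; first by apply: (alg_comp ipP M_alg) => //; exact: (alg_comp ipP M_alg).
  suff -> : ip (y c f) f = ip (x (w c f)) (w c f) by exact: x0.
  rewrite /y /w' /w !fctE (ipDl ipP) (ipDr ipP) (ipZl ipP) (ipZr ipP).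
  by rewrite (adjoint_sym ipP uu').
have cuxu : cone (u' \o x \o u).
  split=> [|f]; first by apply: (alg_comp ipP M_alg) => //; exact: (alg_comp ipP M_alg).
  by rewrite /= (adjoint_sym ipP uu').
have fuxu : fin (u' \o x \o u).
  by split=> //; rewrite trace_conj //; [exact: fx.2 | exact: adjoint_sym].
have yE c f g : ip (y c f) g = ip (x f) g + c * ip (x (u f)) g
     + c^* * ip (u' (x f)) g + c^* * c * ip (u' (x (u f))) g.
  rewrite /y /w' /w !fctE.
  rewrite !(linD xl, linZ xl) !(linD u'l, linZ u'l).
  by rewrite !(ipDl ipP, ipZl ipP); ring.
clearbody y.
have fy c : c^* * c = 1 -> fin (y c).
  move=> c1; split; first exact: cy.
  have e : y c + y (- c) = (x + x) + ((u' \o x \o u) + (u' \o x \o u)).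
    apply/funext => f; apply: (ip_inj ipP) => g.
    change (ip (y c f + y (- c) f) g =
            ip ((x f + x f) + (u' (x (u f)) + u' (x (u f)))) g).
    rewrite !(ipDl ipP) !yE.
    by rewrite rmorphN mulrNN c1; ring.
  apply: le_lt_trans (trace_mono (cy c) (cy (- c))) _; rewrite e.
  have [fxx _] := fin_traceD fx fx; have [fuu _] := fin_traceD fuxu fuxu.
  by case: (fin_traceD fxx fuu) => -[].
have iy c : c^* * c = 1 -> trace_ideal ip M tau (c^* *: y c).
  by move=> c1; exists (c^* * tr (y c)); apply/trace_valZ/trace_val_fin/fy.
have i2 := sqrCi C.
have ii : 'i^* * 'i = 1 :> C by rewrite conjCi mulNr -expr2 i2 opprK.
have nn (c : C) : c^* * c = 1 -> (- c)^* * (- c) = 1 by rewrite rmorphN mulrNN.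
have o1 : 1^* * 1 = 1 :> C by rewrite rmorph1 mulr1.
have [z1 t1] := iy _ o1; have [z2 t2] := iy _ (nn _ o1).
have [z3 t3] := iy _ ii; have [z4 t4] := iy _ (nn _ ii).
exists (4^-1 * (z1 + z2 + (z3 + z4))).
have -> : x \o u = 4^-1 *: ((1^* *: y 1 + (- 1)^* *: y (- 1)) +
                            ('i^* *: y 'i + (- 'i)^* *: y (- 'i))).
  apply/funext => f; apply: (ip_inj ipP) => g; 
  change (ip (x (u f)) g = ip (4^-1 *: ((1^* *: y 1 f + (- 1)^* *: y (- 1) f) +
                               ('i^* *: y 'i f + (- 'i)^* *: y (- 'i) f))) g).
  rewrite !(ipDl ipP, ipZl ipP) !yE !rmorphN /= !rmorph1 !conjCi.
  by field: i2.
by apply: trace_valZ; apply: trace_valD; exact: trace_valD.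
Qed.

End Traces.

(** * Orthogonal projections and braids *)

Section OrthogonalProjections.
Variable R : realType.
Variables (E : lmodType R[i]) (ip : E -> E -> R[i]) (W : set E).
Hypothesis ipP : inner_product ip.
Hypothesis WB : forall x y, W x -> W y -> W (x - y).

Lemma orth_proj_fix P w : is_orth_proj ip W P -> W w -> P w = w.
Proof.
move=> PP Ww; have [WP /(_ (w - P w) (WB Ww WP))] := PP w.
by move/(ip_eq0 ipP)/eqP; rewrite subr_eq0 => /eqP.
Qed.

Lemma orth_proj_adjoint P : is_orth_proj ip W P -> adjoint ip P P.
Proof.
move=> PP x y; have [Wx ox] := PP x; have [Wy oy] := PP y.
have /eqP := ox _ Wy; have /eqP := oy _ Wx; rewrite !(ipBl ipP) !subr_eq0.
by move=> /eqP yx /eqP ->; rewrite (ipC ipP) yx -(ipC ipP).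
Qed.

Lemma orth_proj_uniq P Q : is_orth_proj ip W P -> is_orth_proj ip W Q -> P = Q.
Proof.
move=> PP QP; apply/funext => x; have [WP oP] := PP x; have [WQ oQ] := QP x.
apply/eqP; rewrite -subr_eq0; apply/eqP/(ip_eq0 ipP).
have Wd := WB WP WQ; have /eqP := oP _ Wd; have /eqP := oQ _ Wd.
rewrite !(ipBl ipP x) !subr_eq0 => /eqP e /eqP; rewrite e => e'.
by rewrite (ipBl ipP (P x)) -e' subrr.
Qed.

End OrthogonalProjections.

Section Braids.
Variable N : nat.

Lemma braid_perm1 : braid_perm (1%g : braid N) = 1%g.
Proof. by rewrite braid_permE /word_perm big_nil. Qed.

Lemma braid_permV (x : braid N) : braid_perm x^-1%g = (braid_perm x)^-1%g.
Proof.
by apply: (mulgI (braid_perm x)); rewrite mulgV -braid_permM mulgV braid_perm1.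
Qed.

Lemma braid_perm_onto (s : 'S_N) : exists x : braid N, braid_perm x = s.
Proof.
pose Q (s : 'S_N) := exists x : braid N, braid_perm x = s.
have QM s1 s2 : Q s1 -> Q s2 -> Q (s1 * s2)%g.
  by move=> [x <-] [y <-]; exists (x * y)%g; exact: braid_permM.
(* Induction on the distance of [a] and [b]: conjugating the adjacent transposition of [c = b - 1]
   and [b] by that of [a] and [c] gives the transposition of [a] and [b]. *)
have Qlt k (a b : 'I_N) : b = (a + k.+1)%N :> nat -> Q (tperm a b).
  elim: k a b => [|k IH] a b ab.
    have aN : (a < N.-1)%N by have := ltn_ord b; lia.
    exists (braid_gen (Ordinal aN)); rewrite braid_perm_gen /adj_transp.
    by congr tperm; apply/val_inj => //=; rewrite ab addn1.
  have cN : (a + k.+1 < N)%N by have := ltn_ord b; lia.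
  pose c := Ordinal cN.
  have c1N : (c < N.-1)%N by have := ltn_ord b; rewrite /=; lia.
  have Qac : Q (tperm a c) by apply: IH.
  have Qcb : Q (tperm c b).
    exists (braid_gen (Ordinal c1N)); rewrite braid_perm_gen /adj_transp.
    by congr tperm; apply/val_inj => //=; rewrite ab; lia.
  have [ac cb ab'] : [/\ a != c, c != b & a != b].
    by split; rewrite -val_eqE /=; lia.
  by rewrite -(tperm_swap ac cb ab'); apply: (QM _ _ (QM _ _ _ _)).
have Qt (a b : 'I_N) : Q (tperm a b).
  have [ab|ab|/val_inj ->] := ltngtP a b.
  - by apply: (Qlt (b - a).-1); lia.
  - by rewrite tpermC; apply: (Qlt (a - b).-1); lia.
  - by rewrite tperm1; exists 1%g; exact: braid_perm1.
have [ts -> _] := prod_tpermP s.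
apply: (big_ind Q) => [|//|i _]; [by exists 1%g; exact: braid_perm1 | exact: Qt].
Qed.

Definition braid_lift (s : 'S_N) : braid N := sval (cid (braid_perm_onto s)).

Lemma braid_liftK s : braid_perm (braid_lift s) = s.
Proof. exact: svalP (cid (braid_perm_onto s)). Qed.

Local Notation brw u := (\pi_(braid N) u)%qT.

Lemma braid_ind (P : braid N -> Prop) : P 1%g ->
  (forall i x, P x -> P (braid_gen i * x)%g) ->
  (forall i x, P x -> P ((braid_gen i)^-1 * x)%g) -> forall x, P x.
Proof.
move=> P1 Pg Pi x; rewrite -[x]reprK; elim: (repr x) => [//|[i e] u IH].
have piM v w : brw (v ++ w) = (brw v * brw w)%g.
  by apply/braid_eqP/BraidSym/BraidCat; exact: braid_repr.
rewrite -[_ :: u]/([:: (i, e)] ++ u) piM; case: e; first exact: Pg.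
suff -> : brw [:: (i, false)] = (braid_gen i)^-1%g by exact: Pi.
apply: (mulIg (braid_gen i)); rewrite mulVg -piM.
exact/braid_eqP/BraidCancel.
Qed.

End Braids.

(** * Vectors fixed by the pure braids, and the projection onto the invariants of [U] *)

Section BraidRepresentation.
Variables (R : realType) (N : nat).
Local Notation C := R[i].
Variables (V : vectType C) (ipV : V -> V -> C) (pi : braid N -> 'End(V)).
Variable p : 'End(V).
Hypotheses (ipVP : inner_product ipV).
Hypothesis pi_rep : unitary_rep ipV (fun beta v => pi beta v).
Let Vpi := [set v : V | forall beta, pure_braid beta -> pi beta v = v].
Hypothesis pP : is_orth_proj ipV Vpi p.

Let pi1 v : pi 1%g v = v.
Proof. by case: pi_rep => /funeqP /(_ v). Qed.

Let piM x y v : pi (x * y)%g v = pi x (pi y v).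
Proof. by case: pi_rep => _ /(_ x y) /funeqP /(_ v). Qed.

Let pi_ip x v w : ipV (pi x v) (pi x w) = ipV v w.
Proof. by case: pi_rep. Qed.

Lemma rep_inv_adjoint x v w : ipV (pi x v) w = ipV v (pi x^-1%g w).
Proof. by rewrite -{1}[w]pi1 -(mulgV x) piM pi_ip. Qed.

Lemma pure_fixed_sub v w : Vpi v -> Vpi w -> Vpi (v - w).
Proof. by move=> hv hw b pb; rewrite linearB /= hv ?hw. Qed.

(** Normality of the pure braid group: [b x = x (x^-1 b x)], and the conjugate is again pure. *)
Lemma pure_fixed_stable x v : Vpi v -> Vpi (pi x v).
Proof.
move=> hv b pb; rewrite -piM -[(b * x)%g](mulKVg x) piM (hv (_ * _)%g) //.
by rewrite /pure_braid /= !braid_permM braid_permV pb mul1g mulVg.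
Qed.

Lemma proj_fix v : Vpi v -> p v = v.
Proof. exact: (orth_proj_fix ipVP pure_fixed_sub pP). Qed.

Lemma proj_pure v : Vpi (p v).
Proof. by case: (pP v). Qed.

Lemma proj_idem v : p (p v) = p v.
Proof. exact/proj_fix/proj_pure. Qed.

Lemma proj_adjoint : adjoint ipV p p.
Proof. exact: (orth_proj_adjoint ipVP pP). Qed.

(** The representation of [S_N] induced by [pi] on the range of [p], extended by 0 to its orthogonal
    complement. *)
Definition pure_rep (s : 'S_N) : 'End(V) := (pi (braid_lift s) \o p)%VF.

(** Two braids over the same permutation differ by a pure braid, which fixes the range of [p]; so
    the chosen lift is immaterial. *)
Lemma pure_repE x v : pi x (p v) = pure_rep (braid_perm x) v.
Proof.
rewrite lfunE /= -{1}(mulKVg (braid_lift (braid_perm x)) x) piM.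
rewrite [pi (_ * _)%g _]proj_pure // /pure_braid /=.
by rewrite braid_permM braid_permV braid_liftK mulVg.
Qed.

Lemma pure_rep1 : pure_rep 1%g = p.
Proof. by apply/lfunP => v; rewrite -braid_perm1 -pure_repE pi1. Qed.

Lemma proj_pure_rep s v : p (pure_rep s v) = pure_rep s v.
Proof. by apply: proj_fix; rewrite lfunE; exact/pure_fixed_stable/proj_pure. Qed.

Lemma rep_pure_rep x s v : pi x (pure_rep s v) = pure_rep (braid_perm x * s)%g v.
Proof.
rewrite [pure_rep s v]lfunE /= -piM pure_repE.
by rewrite braid_permM braid_liftK.
Qed.

Lemma pure_repM s r v : pure_rep (s * r)%g v = pure_rep s (pure_rep r v).
Proof.
by rewrite [RHS]lfunE /= proj_pure_rep rep_pure_rep braid_liftK.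
Qed.

Lemma pure_rep_adjoint s : adjoint ipV (pure_rep s) (pure_rep s^-1%g).
Proof.
move=> v w; rewrite -proj_pure_rep proj_adjoint lfunE /= rep_inv_adjoint proj_adjoint.
by rewrite pure_repE proj_pure_rep braid_permV braid_liftK.
Qed.

Section InvariantProjection.
Variables (E K : lmodType C) (ipE : E -> E -> C) (ipK : K -> K -> C).
Variables (t : E -> V -> K) (S : 'S_N -> E -> E).
Hypotheses (ipEP : inner_product ipE) (ipKP : inner_product ipK).
Hypotheses (tP : hilbert_tensor ipE ipV ipK t) (S_rep : unitary_rep ipE S).
Local Notation tens := (tens_op ipK t).
Local Notation U x := (tens (S (braid_perm x)) (pi x)).

Lemma unitary_rep_bounded (s : 'S_N) : bounded_op ipE (S s).
Proof.
case: S_rep => _ _ Sl Si; apply/(bounded_opE _ ipEP).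
by apply: isometry_bounded => // x; exact: Si.
Qed.

Lemma unitary_rep_adjoint (s : 'S_N) : adjoint ipE (S s) (S s^-1%g).
Proof.
case: S_rep => S1 SM _ Si x y.
by rewrite -{1}[y]/(id y) -S1 -(mulgV s) SM Si.
Qed.

Let Sb := unitary_rep_bounded.

Lemma tensor_rep1 : U 1%g = id.
Proof.
have -> : pi 1%g = \1%VF by apply/lfunP => v; rewrite lfunE.
by rewrite braid_perm1; case: S_rep => -> _ _ _; apply: tens1 tP.
Qed.

Lemma tensor_repM x y : U (x * y)%g = U x \o U y.
Proof.
rewrite (tens_comp ipEP ipVP ipKP tP) // braid_permM; case: S_rep => _ -> _ _.
by congr tens_op; apply/lfunP => v; rewrite lfunE /= piM.
Qed.

Lemma tensor_rep_adjoint x : adjoint ipK (U x) (U x^-1%g).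
Proof.
apply: (tens_adjoint ipEP ipVP ipKP tP) => //; last exact: rep_inv_adjoint.
by rewrite braid_permV; exact: unitary_rep_adjoint.
Qed.

Let WU := [set f : K | forall i, U (@braid_gen N i) f = f].

Lemma invariant_all f : WU f -> forall x, U x f = f.
Proof.
move=> hf; elim/braid_ind => [|i x IH|i x IH]; first by rewrite tensor_rep1.
  by rewrite tensor_repM /= IH.
rewrite tensor_repM /= IH -{1}(hf i) -[LHS]/((U (braid_gen i)^-1 \o U (braid_gen i))%g f).
by rewrite -tensor_repM mulVg tensor_rep1.
Qed.

(* For fixed [xi], the vector of [V] representing [w] against the [t xi v] is
   fixed by the pure braids, because these act on the second factor only. *)
Lemma proj_invariant w : WU w -> tens id p w = w.
Proof.
move=> /invariant_all hw.
have ib : bounded_op ipE id by apply/(bounded_opE _ ipEP)/isometry_bounded.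
have [_ t_linr t_ip _] := tP.
apply: (tensor_ip_ext ipKP tP) => xi v.
rewrite (tens_adjoint ipEP ipVP ipKP tP ib ib _ proj_adjoint) //.
rewrite (tensE ipEP ipVP ipKP tP) //.
have [n [e [eo es]]] := orthonormal_basis_exists ipVP.
pose u := \sum_i ipK w (t xi (e i)) *: e i.
have uE v' : ipV u v' = ipK w (t xi v').
  rewrite {2}[v']es (lin_sum (t_linr xi)) (ip_suml ipVP) (ip_sumr ipKP).
  apply: eq_bigr => i _.
  by rewrite (linZ (t_linr xi)) (ipZl ipVP) (ipZr ipKP) mulrC -(ipC ipVP).
rewrite -!uE -proj_adjoint proj_fix // => b pb; apply: (ip_inj ipVP) => v'.
rewrite rep_inv_adjoint !uE -[in RHS](hw b) tensor_rep_adjoint.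
rewrite (tensE ipEP ipVP ipKP tP) //.
rewrite braid_permV pb invg1; case: S_rep => -> //.
Qed.

(** The right-hand side satisfies the defining property of the projection: left translation permutes
    the summands, so its range is invariant, and every summand of the image of [f] pairs with an
    invariant [w] to [ipK f w]. Uniqueness concludes. *)
Lemma invariant_projE P : is_orth_proj ipK WU P ->
  P = (N`!)%:R^-1 *: \sum_s tens (S s) (pure_rep s).
Proof.
move=> PP; have tl a b (ab : bounded_op ipE a) := tens_linear ipEP ipVP ipKP tP b ab.
have ib : bounded_op ipE id by apply/(bounded_opE _ ipEP)/isometry_bounded.
apply: (orth_proj_uniq ipKP _ PP) => [f g hf hg i|f].
  by rewrite (linB (tl _ _ (Sb _))) hf hg.
rewrite scalrfctE fct_sumE; split=> [i|w Ww].
  rewrite (linZ (tl _ _ (Sb _))) (lin_sum (tl _ _ (Sb _))); congr (_ *: _).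
  rewrite [RHS](reindex_inj (mulgI (braid_perm (braid_gen i)))) /=.
  apply: eq_bigr => s _.
  rewrite -[LHS]/((U (braid_gen i) \o tens (S s) (pure_rep s)) f).
  rewrite (tens_comp ipEP ipVP ipKP tP) //; case: S_rep => _ -> _ _.
  by congr (tens_op _ _ _ _ f); apply/lfunP => v; rewrite lfunE /= rep_pure_rep.
have sE s : ipK (tens (S s) (pure_rep s) f) w = ipK f w.
  have -> : tens (S s) (pure_rep s) = U (braid_lift s) \o tens id p.
    by rewrite (tens_comp ipEP ipVP ipKP tP) // braid_liftK.
  rewrite /= tensor_rep_adjoint invariant_all //.
  by rewrite (tens_adjoint ipEP ipVP ipKP tP ib ib _ proj_adjoint) // proj_invariant.
rewrite (ipBl ipKP) (ipZl ipKP) (ip_suml ipKP) (eq_bigr (fun=> ipK f w)) //.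
by rewrite sumr_const card_Sn -[X in _ * X]mulr_natl mulrA mulVf ?mul1r ?subrr //.
Qed.

End InvariantProjection.
End BraidRepresentation.

(** * Crossed products *)

Lemma l2_inner_product (R : realType) (N : nat) (E : lmodType R[i])
    (ipE : E -> E -> R[i]) : inner_product ipE -> inner_product (@l2_ip R N E ipE).
Proof.
move=> ipEP; split=> [a f g h|f g|f|f /eqP].
- rewrite /l2_ip mulr_sumr -big_split /=; apply: eq_bigr => s _.
  by rewrite !ffunE (ip_lin ipEP).
- by rewrite /l2_ip rmorph_sum /=; apply: eq_bigr => s _; rewrite -(ipC ipEP).
- by apply: sumr_ge0 => s _; exact: ip_ge0.
- rewrite psumr_eq0 => [/allP f0|s _]; last exact: ip_ge0.
  apply/ffunP => s; rewrite ffunE; apply/(ip_eq0 ipEP)/eqP.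
  by have := f0 s; rewrite mem_index_enum; apply.
Qed.

Section CrossedProducts.
Variables (R : realType) (N : nat).
Local Notation C := R[i].
Variables (E : lmodType C) (ipE : E -> E -> C).
Hypothesis ipEP : inner_product ipE.
Local Notation l2E := {ffun 'S_N -> E}.
Local Notation ip2 := (@l2_ip R N E ipE).

Lemma l2_hilbert_tensor (V : vectType C) (K : lmodType C) (ipV : V -> V -> C)
    (ipK : K -> K -> C) (t : E -> V -> K) :
  inner_product ipV -> inner_product ipK -> hilbert_tensor ipE ipV ipK t ->
  hilbert_tensor ip2 ipV (@l2_ip R N K ipK) (l2_tensor t).
Proof.
move=> ipVP ipKP tP; have [tl tr ti _] := tP; split=> [v a f g|f a v w|f g v w|F].
- by apply/ffunP => s; rewrite !ffunE tl.
- by apply/ffunP => s; rewrite !ffunE tr.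
- by rewrite /l2_ip mulr_suml; apply: eq_bigr => s _; rewrite !ffunE ti.
have [n [e eP]] := orthonormal_basis_exists ipVP.
exists n, (fun i => [ffun s => slice tP eP i (F s)]), e.
apply/ffunP => s; rewrite sum_ffunE {1}[F s](sliceE tP eP).
by apply: eq_bigr => i _; rewrite !ffunE.
Qed.

Variable S : 'S_N -> E -> E.
Hypothesis S_rep : unitary_rep ipE S.
Local Notation emb := (cp_emb S).
Local Notation shift := (@cp_shift R N E).
Local Notation act := (conj_act S).

Let SK s f : S s (S s^-1%g f) = f.
Proof.
case: S_rep => S1 SM _ _.
by rewrite -[LHS]/((S s \o S s^-1%g) f) -SM mulgV S1.
Qed.

Let Sl s : linear (S s). Proof. by case: S_rep. Qed.

Let Si s f g : ipE (S s f) (S s g) = ipE f g. Proof. by case: S_rep. Qed.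

Lemma conj_act_bounded s a : bounded_op ipE a -> bounded_op ipE (act s a).
Proof.
move=> /(bounded_opE _ ipEP) ab; apply/(bounded_opE _ ipEP).
have Sb r := (bounded_opE (S r) ipEP).1 (unitary_rep_bounded ipEP S_rep r).
exact: bounded_map_comp (Sb _) (bounded_map_comp ab (Sb _)).
Qed.

Lemma conj_act_ip s a f : ipE (act s a f) f = ipE (a (S s^-1%g f)) (S s^-1%g f).
Proof. by rewrite /conj_act /= -{2}[f](SK s) Si. Qed.

Lemma conj_act_positive s a : positive_op ipE a -> positive_op ipE (act s a).
Proof. by move=> a0 f; rewrite conj_act_ip. Qed.

Lemma conj_act1 a : act 1%g a = a.
Proof. by rewrite /conj_act invg1; case: S_rep => ->. Qed.

Lemma conj_actM s r a : act (s * r)%g a = act s (act r a).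
Proof.
by case: S_rep => _ SM _ _; apply/funext => f; rewrite /conj_act invMg !SM.
Qed.

Lemma conj_actZ s c a : act s (c *: a) = c *: act s a.
Proof. by apply/funext => f; rewrite /conj_act /= (linZ (@Sl _)). Qed.

Lemma conj_act_sum s I r (P : pred I) (a : I -> E -> E) :
  act s (\sum_(i <- r | P i) a i) = \sum_(i <- r | P i) act s (a i).
Proof.
apply/funext => f; rewrite /conj_act fct_sumE /= fct_sumE.
by rewrite (lin_sum (@Sl _)).
Qed.

Lemma cp_emb_linear c a b : emb (c *: a + b) = c *: emb a + emb b.
Proof.
apply/funext => f; apply/ffunP => s; rewrite !ffunE.
by rewrite /conj_act /= Sl.
Qed.

Lemma cp_emb_bounded a : bounded_op ipE a -> bounded_op ip2 (emb a).
Proof.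
move=> ab; apply/(bounded_opE _ (l2_inner_product N ipEP)); split=> [c f g|].
  by apply/ffunP => s; rewrite !ffunE (conj_act_bounded _ ab).1.
have [al [k k0 ak]] := (bounded_opE a ipEP).1 ab.
exists k => // f; rewrite /l2_ip mulr_sumr; apply: ler_sum => s _.
by rewrite !ffunE /conj_act /= Si (le_trans (ak _)) // Si.
Qed.

Lemma cp_emb_positive a : positive_op ipE a -> positive_op ip2 (emb a).
Proof.
move=> a0 f; apply: sumr_ge0 => s _; rewrite ffunE.
exact: conj_act_positive.
Qed.

Lemma cp_shift_ip r f g : ip2 (shift r f) (shift r g) = ip2 f g.
Proof.
rewrite /l2_ip [RHS](reindex_inj (mulgI r^-1%g)) /=.
by apply: eq_bigr => s _; rewrite !ffunE.
Qed.

Lemma cp_shift_bounded r : bounded_op ip2 (shift r).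
Proof.
apply/(bounded_opE _ (l2_inner_product N ipEP))/isometry_bounded => [c f g|f].
  by apply/ffunP => s; rewrite !ffunE.
exact: cp_shift_ip.
Qed.

Lemma cp_shiftM r s : shift r \o shift s = shift (r * s)%g.
Proof.
by apply/funext => f; apply/ffunP => u; rewrite !ffunE invMg mulgA.
Qed.

Lemma cp_shift1 : shift 1%g = id.
Proof. by apply/funext => f; apply/ffunP => u; rewrite !ffunE invg1 mul1g. Qed.

Lemma cp_shiftV r : shift r^-1%g \o shift r = id.
Proof. by rewrite cp_shiftM mulVg cp_shift1. Qed.

Lemma cp_shift_adjoint r : adjoint ip2 (shift r) (shift r^-1%g).
Proof.
move=> f g; rewrite -[in RHS](cp_shift_ip r).
by rewrite -[shift r (shift _ g)]/((shift r \o shift r^-1%g) g) cp_shiftM mulgV cp_shift1.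
Qed.

(** In the crossed product the action becomes inner, implemented by the shifts. *)
Lemma cp_covariance r a : emb (act r a) = shift r \o emb a \o shift r^-1%g.
Proof.
apply/funext => f; apply/ffunP => s; rewrite !ffunE -conj_actM invMg !invgK.
by rewrite mulKVg.
Qed.

Section Algebra.
Variable M : set (E -> E).
Hypothesis M_alg : operator_algebra ipE M.

Lemma crossed_product_alg : operator_algebra ip2 (crossed_product S ipE M).
Proof. exact: vN_gen_alg. Qed.

Lemma cp_emb_in a : M a -> crossed_product S ipE M (emb a).
Proof.
move=> Ma; apply: sub_vN_gen; first by left; exists a.
exact/cp_emb_bounded/(alg_bounded M_alg).
Qed.

Lemma cp_shift_in r : crossed_product S ipE M (shift r).
Proof. by apply: sub_vN_gen; [right; exists r | exact: cp_shift_bounded]. Qed.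

End Algebra.

Section TensorEntries.
Variables (V : vectType C) (K : lmodType C) (ipV : V -> V -> C) (ipK : K -> K -> C).
Variable t : E -> V -> K.
Hypotheses (ipVP : inner_product ipV) (ipKP : inner_product ipK).
Hypothesis tP : hilbert_tensor ipE ipV ipK t.

(** As a block matrix over [S_N], the operator has one block in each row: in row [s] it sits in
    column [r^-1 * s]. *)
Lemma tens_cp_entry a r (b : 'End(V)) F s : bounded_op ipE a ->
  tens_op (l2_ip ipK) (l2_tensor t) (emb a \o shift r) b F s =
  tens_op ipK t (act s^-1%g a) b (F (r^-1 * s)%g).
Proof.
move=> ab; have t2P := l2_hilbert_tensor ipVP ipKP tP.
have ipK2P := l2_inner_product N ipKP.
pose X (F : {ffun 'S_N -> K}) : {ffun 'S_N -> K} :=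
  [ffun s => tens_op ipK t (act s^-1%g a) b (F (r^-1 * s)%g)].
have aSb u := conj_act_bounded u ab.
suff -> : tens_op (l2_ip ipK) (l2_tensor t) (emb a \o shift r) b = X by rewrite ffunE.
apply: (tens_uniq (l2_inner_product N ipEP) ipVP ipK2P t2P).
- apply/(bounded_opE _ (l2_inner_product N ipEP)).
  apply: (bounded_map_comp (ipF := ip2)); apply/(bounded_opE _ (l2_inner_product N ipEP)).
    exact: cp_shift_bounded.
  exact: cp_emb_bounded.
- move=> c f g; apply/ffunP => u; rewrite !ffunE.
  by rewrite (tens_linear ipEP ipVP ipKP tP).
- move=> f v; apply/ffunP => u; rewrite !ffunE.
  by rewrite (tensE ipEP ipVP ipKP tP) //.
Qed.

End TensorEntries.
End CrossedProducts.

(** * The product trace on elementary tensors *)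

Section TensorTraces.
Variable R : realType.
Local Notation C := R[i].
Variables (E : lmodType C) (V : vectType C) (K : lmodType C).
Variables (ipE : E -> E -> C) (ipV : V -> V -> C) (ipK : K -> K -> C).
Variable t : E -> V -> K.
Hypotheses (ipEP : inner_product ipE) (ipVP : inner_product ipV).
Hypotheses (ipKP : inner_product ipK) (tP : hilbert_tensor ipE ipV ipK t).
Variable M : set (E -> E).
Hypothesis M_alg : operator_algebra ipE M.
Local Notation tens := (tens_op ipK t).
Local Notation MV := (tens_End ipK t M).

Lemma tens_End_alg : operator_algebra ipK MV.
Proof. exact: vN_gen_alg. Qed.

Lemma tens_in x (b : 'End(V)) : M x -> MV (tens x b).
Proof.
move=> Mx; apply: sub_vN_gen; first by exists x, b.
exact/(tens_bounded ipEP ipVP ipKP tP)/(alg_bounded M_alg).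
Qed.

Variables (tau : (E -> E) -> \bar R) (Tr : (K -> K) -> \bar R).
Hypotheses (tauP : fns_trace ipE M tau) (TrP : fns_trace ipK MV Tr).
Hypothesis Tr_tens : forall x (b : 'End(V)),
  positive_cone ipE M x -> positive_op ipV b ->
  Tr (tens x b) = (tau x * (complex.Re (ntrace b))%:E)%E.

Lemma ntrace_rank1_ge0 v : 0 <= ntrace (rank1 ipV v v).
Proof. by rewrite ntrace_rank1 // divr_ge0 ?ler0n //; exact: ip_ge0. Qed.

Lemma rank1_positive v : positive_op ipV (rank1 ipV v v).
Proof.
move=> w; rewrite rank1E // (ipZl ipVP) (ipC ipVP v w).
by rewrite -normCK exprn_ge0.
Qed.

Lemma ntrace_gt0 (b : 'End(V)) : positive_op ipV b -> b <> 0 -> 0 < ntrace b.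
Proof.
move=> b0 bn0; have bl : linear b by exact: linearP.
have [n [e [l [[eo es] be]]]] :=
  orthonormal_eigenbasis ipVP (positive_op_adjoint ipVP bl b0).
have bE : b = \sum_i l i *: rank1 ipV (e i) (e i).
  apply/lfunP => x; rewrite {1}[x]es linear_sum sum_lfunE; apply: eq_bigr => i _.
  by rewrite lfunE /= (rank1E ipVP) linearZ /= be !scalerA mulrC.
have l0 i : 0 <= l i by have := b0 (e i); rewrite be (ipZl ipVP) eo eqxx mulr1.
pose d := (\dim {:V})%:R^-1 : C.
have trE : ntrace b = \sum_i l i * d.
  rewrite bE.
  apply: (big_ind2 (fun (x : 'End(V)) y => ntrace x = y)) => [|x y x' y' <- <-|i _].
    exact: ntrace0.
    by rewrite -[x]scale1r ntrace_linear mul1r scale1r.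
  by rewrite -[_ *: _]addr0 ntrace_linear ntrace0 addr0 ntrace_rank1 // eo eqxx mul1r.
have d_ge0 : 0 <= d by rewrite invr_ge0 ler0n.
rewrite lt_def trE sumr_ge0 ?andbT => [|i _]; last by rewrite mulr_ge0.
rewrite psumr_eq0 => [|i _]; last by rewrite mulr_ge0.
apply/negP => /allP z; apply: bn0; rewrite bE big1 // => i _.
have := z i; rewrite mem_index_enum mulf_eq0 => /(_ isT) /orP[/eqP ->|].
  by rewrite scale0r.
(* The remaining factor [d] is the inverse of the dimension, which vanishes only for [V = 0], where
   [b = 0]. *)
rewrite invr_eq0 pnatr_eq0 dimv_eq0 => /eqP V0.
by apply/lfunP => x; have := memvf (x : V); rewrite V0 memv0 => /eqP ->; rewrite !linear0.
Qed.

(** Both sides are linear in [b], so [rank1_ind] reduces the claim to positive rank-one operators,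
    where the value of [Tr] is prescribed. *)
Lemma tens_trace_val_positive x (b : 'End(V)) :
  positive_cone ipE M x -> (tau x < +oo)%E ->
  trace_val ipK MV Tr (tens x b) ((fine (tau x))%:C%C * ntrace b).
Proof.
move=> cx xf; have xb := alg_bounded M_alg cx.1.
have mvl := trace_valD ipKP tens_End_alg TrP.
have mvz := trace_valZ ipKP tens_End_alg TrP.
elim/(rank1_ind ipVP): b => [|c b b' IH IH'|v].
- have := trace_val_fin ipKP tens_End_alg TrP (fin_trace0 ipKP tens_End_alg TrP).
  rewrite (trace0 ipKP tens_End_alg TrP) (tens0r ipEP ipVP ipKP tP xb).
  by rewrite ntrace0 mulr0.
- rewrite (tens_linr ipEP ipVP ipKP tP) // ntrace_linear mulrDr mulrCA.
  by apply: mvl => //; exact: mvz.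
have cT : positive_cone ipK MV (tens x (rank1 ipV v v)).
  split; first exact: tens_in cx.1.
  by apply: (tens_rank1_positive ipEP ipVP ipKP tP) => //; case: cx.
have TrE := Tr_tens cx (@rank1_positive v).
have tE := trace_fineK tauP (conj cx xf).
rewrite tE -EFinM in TrE.
suff -> : (fine (tau x))%:C%C * ntrace (rank1 ipV v v) =
          (fine (Tr (tens x (rank1 ipV v v))))%:C%C.
  by apply: (trace_val_fin ipKP tens_End_alg TrP); split=> //; rewrite TrE ltry.
rewrite TrE /= rmorphM /= RRe_real //.
by rewrite ger0_real // ntrace_rank1_ge0.
Qed.

Lemma tens_trace_val x (b : 'End(V)) z : trace_val ipE M tau x z ->
  trace_val ipK MV Tr (tens x b) (z * ntrace b).
Proof.
move=> [x1 [x2 [x3 [x4 [[[c1 f1] [c2 f2] [c3 f3] [c4 f4]] [-> ->]]]]]].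
have Mb y : M y -> bounded_op ipE y := alg_bounded M_alg (T := y).
have [b1 b2 b3 b4] : [/\ bounded_op ipE x1, bounded_op ipE x2,
    bounded_op ipE x3 & bounded_op ipE x4].
  by split; apply: Mb; [case: c1|case: c2|case: c3|case: c4].
have tB y y' : bounded_op ipE y -> bounded_op ipE y' ->
    tens (y - y') b = tens y b - tens y' b.
  move=> yb yb'; rewrite addrC -scaleN1r (tens_linl ipEP ipVP ipKP tP) //.
  by rewrite scaleN1r addrC.
have bB y y' : bounded_op ipE y -> bounded_op ipE y' -> bounded_op ipE (y - y').
  move=> /(bounded_opE _ ipEP) yb /(bounded_opE _ ipEP) yb'.
  apply/(bounded_opE _ ipEP)/bounded_mapD => //.
  by rewrite -scaleN1r; exact: bounded_mapZ.
have -> : tens (x1 - x2 + 'i *: (x3 - x4)) b =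
          tens x1 b - tens x2 b + 'i *: (tens x3 b - tens x4 b).
  rewrite -!tB // [LHS](congr1 (tens^~ b) (addrC _ _)) [RHS]addrC.
  by apply: (tens_linl ipEP ipVP ipKP tP); exact: bB.
rewrite mulrDl mulrBl -mulrA mulrBl.
apply: (trace_valD ipKP tens_End_alg TrP).
  apply: (trace_valD ipKP tens_End_alg TrP); first exact: tens_trace_val_positive.
  by apply: trace_valN; exact: tens_trace_val_positive.
apply: (trace_valZ ipKP tens_End_alg TrP). 
apply: (trace_valD ipKP tens_End_alg TrP); first exact: tens_trace_val_positive.
by apply: trace_valN; exact: tens_trace_val_positive.
Qed.

End TensorTraces.

(** * Averages over the symmetric group *)

Section Averages.
Variables (R : realType) (N : nat).
Local Notation C := R[i].
Variables (E : lmodType C) (V : vectType C) (K : lmodType C).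
Variables (ipE : E -> E -> C) (ipV : V -> V -> C) (ipK : K -> K -> C).
Variable t : E -> V -> K.
Hypotheses (ipEP : inner_product ipE) (ipVP : inner_product ipV).
Hypotheses (ipKP : inner_product ipK) (tP : hilbert_tensor ipE ipV ipK t).
Variables (S : 'S_N -> E -> E) (pi : braid N -> 'End(V)) (p : 'End(V)).
Hypotheses (S_rep : unitary_rep ipE S).
Hypothesis pi_rep : unitary_rep ipV (fun beta v => pi beta v).
Hypothesis pP : is_orth_proj ipV
  [set v | forall beta, pure_braid beta -> pi beta v = v] p.
Local Notation tens := (tens_op ipK t).
Local Notation ip2E := (@l2_ip R N E ipE).
Local Notation ip2K := (@l2_ip R N K ipK).
Local Notation tens2 := (tens_op ip2K (l2_tensor t)).
Local Notation br := (pure_rep pi p).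
Local Notation act := (conj_act S).

Let ip2EP : inner_product ip2E := l2_inner_product N ipEP.
Let ip2KP : inner_product ip2K := l2_inner_product N ipKP.
Let t2P : hilbert_tensor ip2E ipV ip2K (l2_tensor t) :=
  l2_hilbert_tensor N ipVP ipKP tP.

Definition average (a : E -> E) (b : 'End(V)) : K -> K :=
  (N`!)%:R^-1 *: \sum_s tens (a \o S s) (b \o br s)%VF.

(** The counterpart of [average] in the regular representation: [S s] is replaced by the shift and
    [a] by its diagonal embedding. *)
Definition cp_average (a : E -> E) (b : 'End(V)) :
    {ffun 'S_N -> K} -> {ffun 'S_N -> K} :=
  (N`!)%:R^-1 *: \sum_s tens2 (cp_emb S a \o @cp_shift R N E s) (b \o br s)%VF.

Let factK : (N`!)%:R^-1 * (N`!)%:R = 1 :> C.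
Proof. by rewrite mulVf // pnatr_eq0 -lt0n fact_gt0. Qed.

Let fact_ge0 : 0 <= (N`!)%:R^-1 :> C.
Proof. by rewrite invr_ge0 ler0n. Qed.

Lemma bounded_op_comp a a' : bounded_op ipE a -> bounded_op ipE a' ->
  bounded_op ipE (a \o a').
Proof.
move=> /(bounded_opE _ ipEP) ab /(bounded_opE _ ipEP) ab'.
exact/(bounded_opE _ ipEP)/(bounded_map_comp ab').
Qed.

Let Sb := unitary_rep_bounded ipEP S_rep.
Let aSb a s (ab : bounded_op ipE a) : bounded_op ipE (a \o S s) :=
  bounded_op_comp ab (Sb s).

Lemma cp_term_bounded a s : bounded_op ipE a ->
  bounded_op ip2E (cp_emb S a \o @cp_shift R N E s).
Proof.
move=> ab; apply/(bounded_opE _ ip2EP)/(bounded_map_comp (ipF := ip2E)).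
  exact/(bounded_opE _ ip2EP)/(cp_shift_bounded ipEP).
exact/(bounded_opE _ ip2EP)/(cp_emb_bounded ipEP S_rep).
Qed.

Lemma average_linear a b : bounded_op ipE a -> linear (average a b).
Proof.
move=> ab; apply: (bounded_mapZ ipKP _ _).1; apply: bounded_map_sum => // s _.
exact/(bounded_opE _ ipKP)/(tens_bounded ipEP ipVP ipKP tP)/aSb.
Qed.

Let inv := [set f : K | forall i,
  tens (S (braid_perm (@braid_gen N i))) (pi (braid_gen i)) f = f].

Lemma average_proj P a b : is_orth_proj ipK inv P -> bounded_op ipE a ->
  tens a b \o P = average a b.
Proof.
move=> PP ab; rewrite (invariant_projE ipVP pi_rep pP ipEP ipKP tP S_rep PP).
apply/funext => f.
have tl := tens_linear ipEP ipVP ipKP tP b ab.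
rewrite /average /= !scalrfctE (linZ tl) !fct_sumE (lin_sum tl); congr (_ *: _).
apply: eq_bigr => s _.
by rewrite -(tens_comp ipEP ipVP ipKP tP).
Qed.

(** The block in row [s] and column [r]: only the summand of index [s * r^-1] moves a function
    supported at [r] to one supported at [s]. *)
Lemma cp_average_delta a b r k s : bounded_op ipE a ->
  cp_average a b [ffun u => if u == r then k else 0] s =
  (N`!)%:R^-1 *: tens (act s^-1%g a) (b \o br (s * r^-1)%g)%VF k.
Proof.
move=> ab; rewrite /cp_average scalrfctE fct_sumE [LHS]ffunE sum_ffunE.
congr (_ *: _); rewrite (bigD1 (s * r^-1)%g) //= [X in _ + X]big1.
  rewrite addr0 (tens_cp_entry ipEP S_rep ipVP ipKP tP) // ffunE.
  by rewrite invMg invgK mulgKV eqxx.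
move=> q qr; rewrite (tens_cp_entry ipEP S_rep ipVP ipKP tP) // ffunE.
have tl := tens_linear ipEP ipVP ipKP tP (b \o br q)%VF
  (conj_act_bounded ipEP S_rep s^-1%g ab).
case: eqP => [e|_]; last by rewrite (lin0 tl).
by case/eqP: qr; rewrite -e invMg invgK mulKVg.
Qed.

Lemma cp_average_delta_ip a b r s xi v eta w : bounded_op ipE a ->
  ip2K (cp_average a b [ffun u => if u == r then t xi v else 0])
       [ffun u => if u == s then t eta w else 0] =
  (N`!)%:R^-1 * (ipE (act s^-1%g a xi) eta * ipV (b (br (s * r^-1)%g v)) w).
Proof.
move=> ab; rewrite /l2_ip (bigD1 s) //= [X in _ + X]big1 => [|u /negPf us].
  rewrite addr0 cp_average_delta // ffunE eqxx (ipZl ipKP).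
  rewrite (tensE ipEP ipVP ipKP tP); last exact: (conj_act_bounded ipEP S_rep).
  by case: tP => _ _ -> _; rewrite lfunE.
by rewrite [X in ipK _ X]ffunE us (ip0r ipKP).
Qed.

(** * Positivity of averages with invariant [a] and commuting [b] *)

Section Positivity.
Variables (a : E -> E) (b : 'End(V)).
Hypotheses (a_bounded : bounded_op ipE a) (a_pos : positive_op ipE a).
Hypothesis a_inv : forall s, act s a = a.
Hypothesis b_pos : positive_op ipV b.
Hypothesis b_comm : forall s v, b (br s v) = br s (b v).

Let SC s : a \o S s = S s \o a.
Proof.
rewrite -{1}(a_inv s) /conj_act; case: S_rep => S1 SM _ _.
by rewrite -[LHS]compA -SM mulVg S1.
Qed.

(** Here [a (x) b] commutes with [P], so the average is the compression [P (a (x) b) P]. *)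
Lemma average_positive P : is_orth_proj ipK inv P -> positive_op ipK (average a b).
Proof.
move=> PP f; have PE := invariant_projE ipVP pi_rep pP ipEP ipKP tP S_rep PP.
have invB x y : inv x -> inv y -> inv (x - y).
  by move=> hx hy i; rewrite (linB (tens_linear ipEP ipVP ipKP tP _ (Sb _))) hx hy.
have tP_comm g : tens a b (P g) = P (tens a b g).
  rewrite -[LHS]/((tens a b \o P) g) average_proj // PE /average !scalrfctE !fct_sumE.
  congr (_ *: _); apply: eq_bigr => s _.
  rewrite -[RHS]/((tens (S s) (br s) \o tens a b) g).
  rewrite (tens_comp ipEP ipVP ipKP tP) // SC.
  by congr (tens_op _ _ _ _ _); apply/lfunP => v; rewrite !lfunE /= b_comm.
have PK g : P (P g) = P g.
  by apply: (orth_proj_fix ipKP invB PP); case: (PP g).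
rewrite -(average_proj b PP a_bounded) /= -PK tP_comm (orth_proj_adjoint ipKP PP).
exact: (tens_positive ipEP ipVP ipKP tP).
Qed.

(** As [a] is invariant, the block in row [s] and column [r] is [a (x) b pi_s pi_{r^-1}] up to the
    factor [1/N!]. Moving [pi_s] to the other side of the inner product turns the double sum into
    [ipK (tens a b g) g] for a single vector [g]. *)
Lemma cp_average_positive : positive_op ip2K (cp_average a b).
Proof.
move=> F; have ib : bounded_op ipE id by apply/(bounded_opE _ ipEP)/isometry_bounded.
have il c := tens_linear ipEP ipVP ipKP tP c ib.
pose g := \sum_r tens id (br r^-1%g) (F r).
have tab := tens_linear ipEP ipVP ipKP tP b a_bounded.
suff -> : ip2K (cp_average a b F) F = (N`!)%:R^-1 * ipK (tens a b g) g.
  by rewrite mulr_ge0 //; exact: (tens_positive ipEP ipVP ipKP tP).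
rewrite /cp_average scalrfctE (ipZl ip2KP); congr (_ * _).
rewrite /l2_ip (ip_sumr ipKP); apply: eq_bigr => s _.
rewrite fct_sumE sum_ffunE (lin_sum tab) !(ip_suml ipKP).
(* The summation index becomes [s * r^-1], so that [r] is the column. *)
rewrite (reindex_inj (mulgI s)) (reindex_inj invg_inj) /=.
apply: eq_bigr => r _.
rewrite (tens_cp_entry ipEP S_rep ipVP ipKP tP) // a_inv invMg invgK mulgKV.
have brA := tens_adjoint ipEP ipVP ipKP tP ib ib (fun _ _ => erefl)
  (pure_rep_adjoint ipVP pi_rep pP s).
rewrite -(brA _ (F s)); congr (ipK _ _).
rewrite -[RHS]/((tens id (br s) \o (tens a b \o tens id (br r^-1%g))) (F r)).
rewrite !(tens_comp ipEP ipVP ipKP tP) //; congr (tens_op _ _ _ _ _).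
apply/lfunP => v; rewrite (comp_lfunE b) (comp_lfunE (br s)) (comp_lfunE b).
by rewrite -b_comm -(pure_repM ipVP pi_rep pP).
Qed.

End Positivity.

(** * Consequences of selfadjointness of the block matrix *)

Section SelfAdjointAverages.
Variables (a : E -> E) (b : 'End(V)).
Hypotheses (a_bounded : bounded_op ipE a) (a_pos : positive_op ipE a).
Hypotheses (a_neq0 : a <> 0) (b_neq0 : b <> 0).
Hypotheses (pb : forall v, p (b v) = b v) (bp : forall v, b (p v) = b v).
Hypothesis ab_sym : adjoint ip2K (cp_average a b) (cp_average a b).

Let act_sym s : adjoint ipE (act s a) (act s a).
Proof.
apply: (positive_op_adjoint ipEP).
  exact: (conj_act_bounded ipEP S_rep s a_bounded).1.
exact: (conj_act_positive S_rep).
Qed.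

(** The block in row [s], column [r] equals the adjoint of the block in row [r], column [s], tested
    on elementary tensors. *)
Lemma cp_average_sym s r xi eta v w :
  ipE (act s^-1%g a xi) eta * ipV (b (br (s * r^-1)%g v)) w =
  ipE (act r^-1%g a xi) eta * ipV v (b (br (r * s^-1)%g w)).
Proof.
have fact_neq0 : (N`!)%:R^-1 != 0 :> C by rewrite invr_eq0 pnatr_eq0 -lt0n fact_gt0.
apply: (mulfI fact_neq0); rewrite -cp_average_delta_ip //.
rewrite ab_sym (ipC ip2KP) cp_average_delta_ip // !rmorphM /=.
by rewrite -(ipC ipEP) -(ipC ipVP) act_sym conj_Creal // ger0_real.
Qed.

Let a_nonzero : exists xi, 0 < ipE (a xi) xi.
Proof.
apply: contrapT => no; apply: a_neq0; apply: (op_ext ipEP a_bounded.1) => [c x y|x].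
  by rewrite !zeroE scaler0 addr0.
rewrite zeroE (ip0l ipEP); apply/eqP; have := a_pos x; rewrite le_eqVlt.
by case/orP => [/eqP <-//|x0]; case: no; exists x.
Qed.

Lemma cp_average_sym_right : adjoint ipV b b.
Proof.
move=> v w; have [xi xi0] := a_nonzero.
have := cp_average_sym 1%g 1%g xi xi v w.
rewrite invg1 mulg1 (pure_rep1 pi_rep pP) (conj_act1 S_rep) !bp.
by move/(mulfI (lt0r_neq0 xi0)).
Qed.

(** Row 1 and column [g^-1] of the block matrix. *)
Let cross g xi eta v w :
  ipE (a xi) eta * ipV (b (br g v)) w = ipE (act g a xi) eta * ipV (br g (b v)) w.
Proof.
have := cp_average_sym 1%g g^-1%g xi eta v w.
rewrite !invg1 !invgK mulg1 mul1g (conj_act1 S_rep) => ->; congr (_ * _).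
by rewrite -cp_average_sym_right -{1}[g]invgK (pure_rep_adjoint ipVP pi_rep pP) !invgK.
Qed.

(** Cancelling the second factor in [cross] gives [act g a = c *: a]. Positivity of both operators
    gives [c >= 0], and iterating up to the order of [g] gives [c ^+ #[g] = 1], so [c = 1]. *)
Lemma cp_average_sym_left g : act g a = a.
Proof.
have [v bv0] : exists v, b v != 0.
  apply: contrapT => no; apply: b_neq0; apply/lfunP => v; rewrite lfunE /=.
  by apply/eqP/negP => /negP bv; case: no; exists v.
(* Nonzero, because [b v] lies in the range of [p], on which [br g] is invertible. *)
pose w := br g (b v).
have w0 : ipV w w != 0.
  apply: contra bv0 => /eqP/(ip_eq0 ipVP) e.
  rewrite -pb -(pure_rep1 pi_rep pP) -(mulVg g).
  by rewrite (pure_repM ipVP pi_rep pP) -/w e linear0.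
pose c := ipV (b (br g v)) w / ipV w w.
have actE : act g a = c *: a.
  apply/funext => xi; apply: (ip_inj ipEP) => eta; rewrite scalrfctE (ipZl ipEP).
  apply: (mulIf w0); rewrite -cross /c mulrAC divfK // mulrC //.
have [xi xi0] := a_nonzero.
have c0 : 0 <= c.
  rewrite -(pmulr_lge0 _ xi0) -(ipZl ipEP) -[_ *: a xi]/((c *: a) xi) -actE.
  exact: (conj_act_positive S_rep).
have ck k : act (g ^+ k)%g a = c ^+ k *: a.
  elim: k => [|k IH]; first by rewrite expr0 scale1r (conj_act1 S_rep).
  by rewrite expgS (conj_actM S_rep) IH (conj_actZ S_rep) actE scalerA exprSr.
have := congr1 (fun y => ipE (y xi) xi) (ck #[g]%g).
rewrite expg_order (conj_act1 S_rep) /= scalrfctE (ipZl ipEP) -{1}[ipE _ _]mul1r.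
move/(mulIf (lt0r_neq0 xi0))/esym/eqP; rewrite pexpr_eq1 ?order_gt0 //.
by move=> /eqP c1; rewrite actE c1 scale1r.
Qed.

Lemma cp_average_sym_comm g v : b (br g v) = br g (b v).
Proof.
apply: (ip_inj ipVP) => w; have [xi xi0] := a_nonzero.
by have := cross g xi xi v w; rewrite cp_average_sym_left => /(mulfI (lt0r_neq0 xi0)).
Qed.

(* On an eigenspace of [b] with eigenvalue [l < 0], of spectral projection [D],
   positivity of [average a b] forces [average a D] to vanish, hence
   [cp_average a D], hence its diagonal entry [a (x) D]. *)
Lemma average_positive_right P : is_orth_proj ipK inv P ->
  (forall D : 'End(V), average a D = 0 -> cp_average a D = 0) ->
  positive_op ipK (average a b) -> positive_op ipV b.
Proof.
move=> PP faithful T0.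
have [n [e [l [[eo es] be]]]] := orthonormal_eigenbasis ipVP cp_average_sym_right.
have lE i : l i = ipV (b (e i)) (e i) by rewrite be (ipZl ipVP) eo eqxx mulr1.
have lr i : l i \is Num.real.
  by rewrite CrealE {2}lE cp_average_sym_right (ipC ipVP) -lE.
suff l0 i : 0 <= l i.
  move=> v; rewrite {1}[v]es linear_sum (ip_suml ipVP); apply: sumr_ge0 => i _.
  rewrite linearZ /= be !(ipZl ipVP) mulrCA mulr_ge0 // (ipC ipVP (e i)).
  by rewrite -normCK exprn_ge0.
rewrite real_leNgt ?real0 //; apply/negP => li; apply: a_neq0.
pose D := \sum_(j | l j == l i) rank1 ipV (e j) (e j).
have DE v : D v = \sum_(j | l j == l i) ipV v (e j) *: e j.
  by rewrite sum_lfunE; apply: eq_bigr => j _; rewrite rank1E.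
have De j : l j == l i -> D (e j) = e j.
  move=> lj; rewrite DE (bigD1 j) //= eo eqxx scale1r big1 ?addr0 // => k /andP[_ kj].
  by rewrite eo eq_sym (negPf kj) scale0r.
have bD v : b (D v) = l i *: D v.
  rewrite DE linear_sum scaler_sumr; apply: eq_bigr => j /eqP lj.
  by rewrite linearZ /= be lj !scalerA mulrC.
have DD v : D (D v) = D v.
  rewrite {1}(DE v) linear_sum [RHS]DE; apply: eq_bigr => j lj.
  by rewrite linearZ /= De.
have Dpos : positive_op ipV D.
  move=> v; rewrite DE (ip_suml ipVP); apply: sumr_ge0 => j _.
  by rewrite (ipZl ipVP) (ipC ipVP (e j)) -normCK exprn_ge0.
have Dsym : adjoint ipV D D by apply: (positive_op_adjoint ipVP) Dpos; exact: linearP.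
(* [br g] commutes with the selfadjoint [b], hence preserves its eigenspaces, and distinct
   eigenspaces are orthogonal. *)
have brl g j k : l j != l k -> ipV (br g (e j)) (e k) = 0.
  move=> jk; apply/eqP; move: (cp_average_sym_right (br g (e j)) (e k)).
  rewrite cp_average_sym_comm !be linearZ /= (ipZl ipVP) (ipZr ipVP) conj_Creal //.
  by move/eqP; rewrite -subr_eq0 -mulrBl mulf_eq0 subr_eq0 (negPf jk).
have Dbr_fix g j : l j == l i -> D (br g (e j)) = br g (e j).
  move=> /eqP lj; rewrite DE [RHS]es big_mkcond /=; apply: eq_bigr => k _.
  by case: eqP => // /eqP lk; rewrite brl ?scale0r // lj eq_sym.
have Dbr g v : D (br g v) = br g (D v).
  rewrite [in LHS](es v) [in RHS](es v) !linear_sum; apply: eq_bigr => j _.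
  rewrite !linearZ /=; congr (_ *: _).
  have [lj|lj] := boolP (l j == l i); first by rewrite Dbr_fix // De.
  rewrite !DE !big1 ?linear0 // => k /eqP lk.
    rewrite eo (_ : (j == k) = false) ?scale0r //.
    by apply/negP => /eqP jk; rewrite jk lk eqxx in lj.
  by rewrite brl ?scale0r // lk.
have Tpos : positive_op ipK (average a D).
  by apply: (average_positive a_bounded a_pos cp_average_sym_left Dpos _ PP) => s v.
have ib : bounded_op ipE id by apply/(bounded_opE _ ipEP)/isometry_bounded.
have TD : average a b \o tens id D = l i *: average a D.
  apply/funext => f; rewrite /average !fctE !fct_sumE scalerA mulrC -scalerA.
  congr (_ *: _); rewrite scaler_sumr; apply: eq_bigr => s _.
  rewrite -[LHS]/((tens (a \o S s) (b \o br s)%VF \o tens id D) f).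
  rewrite (tens_comp ipEP ipVP ipKP tP) //; last exact: aSb.
  have -> : ((b \o br s) \o D)%VF = l i *: (D \o br s)%VF + 0.
    apply/lfunP => v; rewrite addr0 (comp_lfunE _ D) (comp_lfunE b) -Dbr bD.
    by rewrite [RHS]lfunE /= (comp_lfunE D).
  rewrite (tens_linr ipEP ipVP ipKP tP) ?(tens0r ipEP ipVP ipKP tP) ?addr0 //; exact: aSb.
have DT : tens id D \o average a D = average a D.
  have tl := tens_linear ipEP ipVP ipKP tP D ib.
  apply/funext => f; rewrite /average !fctE !fct_sumE (linZ tl) (lin_sum tl).
  congr (_ *: _); apply: eq_bigr => s _.
  rewrite -[LHS]/((tens id D \o tens (a \o S s) (D \o br s)%VF) f).
  rewrite (tens_comp ipEP ipVP ipKP tP) //; last exact: aSb.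
  congr (tens_op _ _ _ _ f); apply/lfunP => v.
  by rewrite (comp_lfunE D) !(comp_lfunE D (br s)) DD.
(* At [(1 (x) D) f] the form of [average a b] is [l i] times that of [average a D] at [f]. Both
   forms are nonnegative and [l i < 0], so the latter is 0. *)
have TD0 : average a D = 0.
  apply: (op_ext ipKP (average_linear D a_bounded)) => [c x y|f].
    by rewrite !zeroE scaler0 addr0.
  rewrite zeroE (ip0l ipKP); apply/eqP; rewrite eq_le Tpos andbT.
  have Dadj := tens_adjoint ipEP ipVP ipKP tP ib ib (fun _ _ => erefl) Dsym.
  have := T0 (tens id D f).
  rewrite -[average a b _]/((average a b \o tens id D) f) TD scalrfctE (ipZl ipKP) -Dadj.
  by rewrite -[tens id D _]/((tens id D \o average a D) f) DT nmulr_rge0.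
apply/funext => xi; rewrite zeroE; apply: (ip_eq0 ipEP).
have := cp_average_delta D 1%g (t xi (e i)) 1%g a_bounded.
rewrite (faithful _ TD0) zeroE ffunE => /esym/eqP.
rewrite scaler_eq0 invr_eq0 pnatr_eq0 -[_ == 0%N]negbK -lt0n fact_gt0 /=.
rewrite invg1 mulg1 (conj_act1 S_rep) (tensE ipEP ipVP ipKP tP) // comp_lfunE.
rewrite (pure_rep1 pi_rep pP).
(* As [l i] is nonzero, [e i] is in the range of [b], which [p] fixes. *)
have -> : p (e i) = e i.
  by have := pb (e i); rewrite be linearZ => /(scalerI (ltr0_neq0 li)).
rewrite De // => /eqP te; have [_ _ tip _] := tP.
by have := tip (a xi) (a xi) (e i) (e i); rewrite te (ip0l ipKP) eo eqxx mulr1.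
Qed.

End SelfAdjointAverages.

(** * Traces of averages in the crossed product *)

Section AverageTraces.
Variable M : set (E -> E).
Hypotheses (M_alg : operator_algebra ipE M).
Hypothesis M_inv : forall s x, M x -> M (act s x).
Local Notation CP := (crossed_product S ipE M).
Local Notation CPV := (tens_End ip2K (l2_tensor t) CP).
Variables (tau : (E -> E) -> \bar R).
Variable tauCP : ({ffun 'S_N -> E} -> {ffun 'S_N -> E}) -> \bar R.
Variable Tr : ({ffun 'S_N -> K} -> {ffun 'S_N -> K}) -> \bar R.
Hypotheses (tauP : fns_trace ipE M tau) (tauCPP : fns_trace ip2E CP tauCP).
Hypothesis TrP : fns_trace ip2K CPV Tr.
Hypothesis tauCP_pos : forall x, positive_cone ipE M x -> tauCP (cp_emb S x) = tau x.
Hypothesis tauCP_def : forall x s, trace_ideal ipE M tau x ->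
  trace_ext ip2E CP tauCP (cp_emb S x \o cp_shift s) =
  (s == 1%g)%:R * trace_ext ipE M tau x.
Hypothesis Tr_def : forall x (b : 'End(V)),
  positive_cone ip2E CP x -> positive_op ipV b ->
  Tr (tens2 x b) = (tauCP x * (complex.Re (ntrace b))%:E)%E.

Let CP_alg : operator_algebra ip2E CP := crossed_product_alg ipE S M.
Let CPV_alg : operator_algebra ip2K CPV := tens_End_alg ip2K (l2_tensor t) CP.
Let Mb x (Mx : M x) : bounded_op ipE x := alg_bounded M_alg Mx.

Lemma cp_term_in x s : M x -> CP (cp_emb S x \o cp_shift s).
Proof.
move=> Mx; apply: (alg_comp ip2EP CP_alg).
  exact: (cp_emb_in ipEP S_rep M_alg).
exact: (cp_shift_in ipEP).
Qed.

Lemma cp_average_in x b : M x -> CPV (cp_average x b).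
Proof.
move=> Mx; apply: (algZ ip2KP CPV_alg); apply: (alg_sum ip2KP CPV_alg) => s _.
by apply: (tens_in ip2EP ipVP ip2KP t2P CP_alg); exact: cp_term_in.
Qed.

(** [tauCP_def] speaks of [trace_ext], which is 0 off the ideal, so it does not show membership.
    This comes from [trace_ideal_unitary], with the shift as the unitary, for each of the four
    positive parts of [x]. *)
Lemma cp_term_ideal x s : trace_ideal ipE M tau x ->
  trace_ideal ip2E CP tauCP (cp_emb S x \o cp_shift s).
Proof.
move=> [z [x1 [x2 [x3 [x4 [[f1 f2 f3 f4] [-> _]]]]]]].
have Sl : forall s, linear (S s) by case: S_rep.
have fin_ideal y : finite_positive ipE M tau y ->
    exists w, trace_val ip2E CP tauCP (cp_emb S y \o cp_shift s) w.
  move=> [cy fy].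
  apply: (trace_ideal_unitary ip2EP CP_alg tauCPP (u' := cp_shift s^-1%g)).
  - split; last by rewrite tauCP_pos.
    split; first exact: (cp_emb_in ipEP S_rep M_alg cy.1).
    exact: (cp_emb_positive S_rep cy.2).
  - exact: (cp_shift_in ipEP).
  - exact: (cp_shift_in ipEP).
  - exact: cp_shift_adjoint.
  - by rewrite cp_shiftM mulgV cp_shift1.
  - exact: cp_shiftV.
have [[w1 t1] [w2 t2]] := (fin_ideal _ f1, fin_ideal _ f2).
have [[w3 t3] [w4 t4]] := (fin_ideal _ f3, fin_ideal _ f4).
exists (w1 - w2 + 'i * (w3 - w4)).
have -> : cp_emb S (x1 - x2 + 'i *: (x3 - x4)) \o cp_shift s =
    (cp_emb S x1 \o cp_shift s) - (cp_emb S x2 \o cp_shift s) +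
    'i *: ((cp_emb S x3 \o cp_shift s) - (cp_emb S x4 \o cp_shift s)).
  have embB y y' : cp_emb S (y - y') = cp_emb S y - cp_emb S y'.
    by rewrite addrC -scaleN1r (cp_emb_linear S_rep) scaleN1r addrC.
  by rewrite addrC (cp_emb_linear S_rep) !embB addrC.
have vD := trace_valD ip2EP CP_alg tauCPP.
apply: (vD); first by apply: (vD) => //; exact: trace_valN.
apply: (trace_valZ ip2EP CP_alg tauCPP).
by apply: (vD) => //; exact: trace_valN.
Qed.

Lemma cp_average_trace x b z : trace_val ipE M tau x z ->
  trace_val ip2K CPV Tr (cp_average x b) (z / (N`!)%:R * ntrace (b \o p)%VF).
Proof.
move=> xz; have xE := trace_val_ext ipEP M_alg tauP xz.
have term s : trace_val ip2K CPV Tr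
    (tens2 (cp_emb S x \o cp_shift s) (b \o br s)%VF)
    ((s == 1%g)%:R * z * ntrace (b \o br s)%VF).
  apply: (tens_trace_val ip2EP ipVP ip2KP t2P CP_alg tauCPP TrP Tr_def).
  have xi : trace_ideal ipE M tau x by exists z.
  rewrite -xE -tauCP_def //.
  exact: (trace_idealP ip2EP CP_alg tauCPP (cp_term_ideal s xi)).
rewrite mulrAC mulrC.
apply: (trace_valZ ip2KP CPV_alg TrP).
suff -> : z * ntrace (b \o p)%VF =
    \sum_(s : 'S_N) (s == 1%g)%:R * z * ntrace (b \o br s)%VF.
  by apply: (trace_val_sum ip2KP CPV_alg TrP) => s _; exact: term.
rewrite (bigD1 1%g) //= eqxx mul1r (pure_rep1 pi_rep pP) big1 ?addr0 // => s /negPf ->.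
by rewrite !mul0r.
Qed.

(** By covariance the action is conjugation by a unitary of the crossed product, under which [tauCP]
    is invariant. *)
Lemma trace_conj_act x s : positive_cone ipE M x -> tau (act s x) = tau x.
Proof.
move=> cx; have cax : positive_cone ipE M (act s x).
  by split; [apply: M_inv; case: cx | apply: (conj_act_positive S_rep); case: cx].
rewrite -!tauCP_pos // (cp_covariance S_rep).
apply: (trace_conj tauCPP); try exact: (cp_shift_in ipEP).
- exact: cp_shift_adjoint.
- by rewrite cp_shiftM mulgV cp_shift1.
- exact: cp_shiftV.
- split; first exact: (cp_emb_in ipEP S_rep M_alg cx.1).
  exact: (cp_emb_positive S_rep cx.2).
Qed.

Lemma cp_averageD x y b : bounded_op ipE x -> bounded_op ipE y ->
  cp_average (x + y) b = cp_average x b + cp_average y b.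
Proof.
move=> xb yb; rewrite /cp_average -scalerDr -big_split /=; congr (_ *: _).
apply: eq_bigr => s _.
rewrite -[tens2 (cp_emb S x \o _) _]scale1r -(tens_linl ip2EP ipVP ip2KP t2P);
  try exact: cp_term_bounded.
by rewrite -{1}[x]scale1r (cp_emb_linear S_rep) !scale1r.
Qed.

Lemma cp_average0l b : cp_average 0 b = 0.
Proof.
have b0 : bounded_op ipE 0 by exact/(bounded_opE _ ipEP)/bounded_map0.
by apply: (@addrI _ (cp_average 0 b)); rewrite -cp_averageD // !addr0.
Qed.

Lemma cp_average0r x : bounded_op ipE x -> cp_average x 0 = 0.
Proof.
move=> xb; rewrite /cp_average big1 ?scaler0 // => s _.
by rewrite comp_lfun0l (tens0r ip2EP ipVP ip2KP t2P) //; exact: cp_term_bounded.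
Qed.

Section PositiveTrace.
Variable b : 'End(V).
Hypothesis b_pos : positive_op ipV b.
Hypothesis b_comm : forall s v, b (br s v) = br s (b v).
Hypothesis bp : (b \o p)%VF = b.

Definition invariant_positive x :=
  [/\ M x, positive_op ipE x & forall s, act s x = x].

Let cp_average_cone x : invariant_positive x -> positive_cone ip2K CPV (cp_average x b).
Proof.
move=> [Mx x0 xi]; split; first exact: cp_average_in.
exact: (cp_average_positive (Mb Mx) x0 xi b_pos b_comm).
Qed.

Let c := (N`!)%:R^-1 * complex.Re (ntrace b).

(** The average is positive and has a complex trace value by [cp_average_trace];
    [trace_val_positive] turns this into a value of [Tr]. *)
Lemma cp_average_trace_finite x : invariant_positive x -> (tau x < +oo)%E ->
  Tr (cp_average x b) = (tau x * c%:E)%E.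
Proof.
move=> xP xf; have cX := cp_average_cone xP; case: (xP) => Mx x0 _.
have fx : finite_positive ipE M tau x by [].
have xz := cp_average_trace b (trace_val_fin ipEP M_alg tauP fx).
have [fX] := trace_val_positive ip2KP CPV_alg TrP cX.2 xz.
rewrite bp (trace_fineK tauP fx) (trace_fineK TrP fX) -EFinM.
move=> /(congr1 (@complex.Re R)) /= <-.
have ReM (r : R) (w : C) : complex.Re (r%:C%C * w) = r * complex.Re w.
  by case: w => u v /=; rewrite mul0r subr0.
have -> : (N`!)%:R^-1 = ((N`!)%:R^-1 : R)%:C%C.
  by rewrite rmorphV ?unitfE ?pnatr_eq0 -?lt0n ?fact_gt0 // rmorph_nat.
by rewrite -rmorphM ReM mulrA.
Qed.

Lemma cp_average_trace_positive x : invariant_positive x ->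
  Tr (cp_average x b) = (tau x * c%:E)%E.
Proof.
move=> xP; case: (xP) => Mx x0 xi; have cX := cp_average_cone xP.
have cx : positive_cone ipE M x by [].
have [xoo|] := eqVneq (tau x) +oo%E; last first.
  by move=> xoo; apply: cp_average_trace_finite; rewrite // ltey.
(* For [b = 0] both sides are 0, by the convention that 0 times infinity is 0; otherwise [c > 0]. *)
have [b0|/eqP bn0] := eqVneq b 0.
  rewrite b0 cp_average0r; last exact: Mb.
  by rewrite (trace0 ip2KP CPV_alg TrP) /c b0 ntrace0 /= mulr0 mule0.
have c0 : 0 < c.
  have := ntrace_gt0 ipVP b_pos bn0; rewrite ltcE /= => /andP[_ r0].
  by rewrite mulr_gt0 // invr_gt0 ltr0n fact_gt0.
rewrite xoo gt0_mulye ?lte_fin //.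
apply/eqP; apply: contraT => Xoo.
have fX : finite_positive ip2K CPV Tr (cp_average x b) by split=> //; rewrite ltey.
have XE := trace_fineK TrP fX.
(* If [Tr] were finite at the average of [x], every finite-trace [y] below [x] would have trace at
   most [Tr (cp_average x b) / c]; semifiniteness would then bound [tau x]. *)
suff : (tau x <= (fine (Tr (cp_average x b)) / c)%:E)%E by rewrite xoo leye_eq.
case: tauP => _ _ _ /(_ x cx) ->; apply: ge_ereal_sup => _ [y [cy yx yf] <-].
have fy : finite_positive ipE M tau y by [].
have fay s : finite_positive ipE M tau (act s y).
  split; last by rewrite trace_conj_act.
  by split; [apply: M_inv; case: cy | apply: (conj_act_positive S_rep); case: cy].
(* Averaging keeps the trace, makes [y] invariant, and stays below [x] because [x] is itself
   invariant. *)
pose y' := (N`!)%:R^-1 *: \sum_s act s y.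
have y'z : trace_val ipE M tau y' ((fine (tau y))%:C%C).
  suff -> : (fine (tau y))%:C%C =
      (N`!)%:R^-1 * \sum_(s : 'S_N) (fine (tau (act s y)))%:C%C.
    apply: (trace_valZ ipEP M_alg tauP); apply: (trace_val_sum ipEP M_alg tauP) => s _.
    exact: (trace_val_fin ipEP M_alg tauP).
  rewrite (eq_bigr (fun=> (fine (tau y))%:C%C)) => [|s _]; last by rewrite trace_conj_act.
  by rewrite sumr_const card_Sn -[X in _ * X]mulr_natl mulrA factK mul1r.
have y'E f : ipE (y' f) f = (N`!)%:R^-1 * \sum_s ipE (act s y f) f.
  by rewrite /y' scalrfctE fct_sumE (ipZl ipEP) (ip_suml ipEP).
have y'0 : positive_op ipE y'.
  move=> f; rewrite y'E mulr_ge0 // sumr_ge0 // => s _.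
  by case: (fay s) => -[].
have y'i s : act s y' = y'.
  rewrite (conj_actZ S_rep) (conj_act_sum S_rep); congr (_ *: _).
  rewrite [RHS](reindex_inj (mulgI s)) /=.
  by apply: eq_bigr => r _; rewrite (conj_actM S_rep).
have [fy' tE] := trace_val_positive ipEP M_alg tauP y'0 y'z.
have My' : M y' by case: fy' => -[].
have tyE : tau y = tau y'.
  by rewrite (trace_fineK tauP fy) (trace_fineK tauP fy'); congr EFin; case: tE.
have y'P : invariant_positive y' by split.
(* The average of [x - y'] is then positive too, so [Tr] at the average of [y'] is at most [Tr] at
   that of [x]. *)
have xy'P : invariant_positive (x - y').
  split; first exact: (algB ipEP M_alg).
    move=> f; rewrite !fctE (ipBl ipEP) subr_ge0 y'E.
    rewrite ler_pdivrMl ?ltr0n ?fact_gt0 //.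
    rewrite mulr_natl -card_Sn -sumr_const; apply: ler_sum => s _.
    by rewrite -(xi s) !(conj_act_ip S_rep) yx.
  move=> s; rewrite addrC -scaleN1r.
  by apply/funext => f; rewrite /conj_act !fctE; case: S_rep => _ _ Sl _; rewrite (Sl s)
    -[S s (y' _)]/(act s y' f) -[S s (x _)]/(act s x f) y'i xi.
rewrite EFinM lee_pdivlMr // -XE tyE -cp_average_trace_finite //; last by case: fy'.
rewrite -(subrK y' x) [_ - _ + _]addrC cp_averageD; try by apply: Mb; case: xy'P.
by apply: (trace_mono TrP); exact: cp_average_cone.
Qed.

End PositiveTrace.
End AverageTraces.
End Averages.

Theorem corollary2p9 (R : realType) (N : nat)
  (* the Hilbert spaces H (separable), V (finite-dimensional), K = H (x) V *)
  (H : completeNormedModType R[i]) (dH : {dot H for Num.conj})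
  (H_norm : forall x : H, `|x| ^+ 2 = dH x x)
  (H_separable : exists2 D : set H, countable D & dense D)
  (V : vectType R[i]) (dV : {dot V for Num.conj})
  (K : lmodType R[i]) (dK : {dot K for Num.conj}) (t : H -> V -> K)
  (K_tensor : hilbert_tensor dH dV dK t)
  (* the representations S of S_N in H, pi of B_N in V, U of B_N in K *)
  (S : 'S_N -> H -> H) (S_rep : unitary_rep dH S)
  (pi : braid N -> 'End(V))
  (pi_rep : unitary_rep dV (fun beta v => pi beta v))
  (U : braid N -> K -> K)
  (U_def : forall beta, U beta = tens_op dK t (S (braid_perm beta)) (pi beta))
  (P_U : K -> K)
  (P_U_def : is_orth_proj dK
     [set f | forall i, U (@braid_gen N i) f = f] P_U)
  (p_pi : 'End(V))
  (p_pi_def : is_orth_proj dV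
     [set v | forall beta, pure_braid beta -> pi beta v = v] p_pi)
  (* the II_infty factor M and its trace *)
  (M : set (H -> H)) (M_factor : II_infty_factor dH M)
  (S_notin_M : forall s, s != 1%g -> ~ M (S s))
  (M_invariant : forall s x, M x -> M (conj_act S s x))
  (Tr_M : (H -> H) -> \bar R) (Tr_M_trace : fns_trace dH M Tr_M)
  (* the crossed product and its trace *)
  (CP : set ({ffun 'S_N -> H} -> {ffun 'S_N -> H}))
  (CP_def : CP = crossed_product S dH M)
  (Tr_CP : ({ffun 'S_N -> H} -> {ffun 'S_N -> H}) -> \bar R)
  (Tr_CP_trace : fns_trace (l2_ip dH) CP Tr_CP)
  (Tr_CP_pos : forall x, positive_cone dH M x -> Tr_CP (cp_emb S x) = Tr_M x)
  (Tr_CP_def : forall x s, trace_ideal dH M Tr_M x ->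
     trace_ext (l2_ip dH) CP Tr_CP (cp_emb S x \o cp_shift s) =
     (s == 1%g)%:R * trace_ext dH M Tr_M x)
  (* (M x| S_N) (x) End(V), with the product trace *)
  (CPV : set ({ffun 'S_N -> K} -> {ffun 'S_N -> K}))
  (CPV_def : CPV = tens_End (l2_ip dK) (l2_tensor t) CP)
  (Tr : ({ffun 'S_N -> K} -> {ffun 'S_N -> K}) -> \bar R)
  (Tr_trace : fns_trace (l2_ip dK) CPV Tr)
  (Tr_def : forall x (b : 'End(V)),
     positive_cone (l2_ip dH) CP x -> positive_op dV b ->
     Tr (tens_op (l2_ip dK) (l2_tensor t) x b) =
     (Tr_CP x * (complex.Re (ntrace b))%:E)%E)
  (* Q_U and its identification with (M x| S_N) (x) End(V) *)
  (Q_U : set (K -> K))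
  (Q_U_def : Q_U = vN_gen dK (tens_End dK t M `|` range U))
  (Theta : (K -> K) -> ({ffun 'S_N -> K} -> {ffun 'S_N -> K}))
  (Theta_iso : star_iso dK (l2_ip dK) Q_U CPV Theta)
  (Theta_Q : forall x (b : 'End(V)), M x ->
     Theta (tens_op dK t x b) =
     tens_op (l2_ip dK) (l2_tensor t) (cp_emb S x) b)
  (Theta_S : forall s,
     Theta (tens_op dK t (S s) \1%VF) =
     tens_op (l2_ip dK) (l2_tensor t) (cp_shift s) \1%VF)
  (A : H -> H) (A_M : M A)
  (B : 'End(V)) (B_comm : (B \o p_pi)%VF = (p_pi \o B)%VF) :
  let T := tens_op dK t A B \o P_U in
  [/\ Q_U T,
      (* Tr_M(A) as a complex number: A in the definition ideal of Tr_M *)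
      trace_ideal dH M Tr_M A ->
      trace_ideal (l2_ip dK) CPV Tr (Theta T) /\
      trace_ext (l2_ip dK) CPV Tr (Theta T) =
      trace_ext dH M Tr_M A / (N`!)%:R * ntrace (B \o p_pi)%VF &
      (* Tr_M(A) in [0, +oo] : A positive, possibly of infinite trace *)
      positive_op dH A -> positive_op dK T ->
      Tr (Theta T) =
      (Tr_M A * ((N`!)%:R^-1 * complex.Re (ntrace (B \o p_pi)%VF))%:E)%E].
Proof.
have ipH := dot_inner_product dH; have ipV := dot_inner_product dV.
have ipK := dot_inner_product dK.
have M_alg : operator_algebra dH M.
  by case: M_factor => [[[_ Mvn] _] _ _ _]; rewrite -Mvn; exact: vN_gen_alg.
have Mb x (Mx : M x) := alg_bounded M_alg Mx.
have Sb := unitary_rep_bounded ipH S_rep.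
have UE : U = fun beta => tens_op dK t (S (braid_perm beta)) (pi beta).
  exact/funext.
rewrite {}UE in P_U_def Q_U_def.
rewrite {CP}CP_def in Tr_CP_trace Tr_CP_def CPV_def Tr_def *.
rewrite {CPV}CPV_def in Tr_trace Theta_iso *.
case: (Theta_iso) => _ Theta_lin Theta_comp Theta_adj.
have QU_alg : operator_algebra dK Q_U by rewrite Q_U_def; exact: vN_gen_alg.
have QU_tens x s b : M x -> Q_U (tens_op dK t (x \o S s) b).
  move=> Mx; pose l := braid_lift s.
  (* [Q_U] is generated by [M (x) End(V)] and the [U beta], so the factor [pi l] contained in [U l]
     is compensated by [pi l^-1]. *)
  have -> : tens_op dK t (x \o S s) b =
      tens_op dK t x (b \o pi l^-1%g)%VF \o tens_op dK t (S (braid_perm l)) (pi l).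
    rewrite (tens_comp ipH ipV ipK K_tensor) ?braid_liftK //; last exact: Mb.
    congr tens_op; apply/lfunP => v; rewrite !comp_lfunE.
    case: pi_rep => /funeqP pi1 /(_ l^-1%g l)/funeqP piM _ _; congr (b _).
    by have := piM v; rewrite /= mulVg => <-; rewrite [RHS]pi1.
  apply: (alg_comp ipK QU_alg); rewrite Q_U_def; apply: sub_vN_gen.
  - by left; exact: (tens_in ipH ipV ipK K_tensor M_alg).
  - exact: (tens_bounded ipH ipV ipK K_tensor _ (Mb _ Mx)).
  - by right; exists l.
  - exact: (tens_bounded ipH ipV ipK K_tensor).
have QU_average x b : M x -> Q_U (average dK t S pi p_pi x b).
  move=> Mx; apply: (algZ ipK QU_alg); apply: (alg_sum ipK QU_alg) => s _.
  exact: QU_tens.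
have Theta0 : Theta 0 = 0.
  apply: (@addrI _ (Theta 0)); have Q0 := alg0 ipK QU_alg.
  by have := Theta_lin 1 0 0 Q0 Q0; rewrite !scale1r !addr0.
have ip2H := l2_inner_product N ipH; have ip2K := l2_inner_product N ipK.
have t2P := l2_hilbert_tensor N ipV ipK K_tensor.
have ThetaD x y : Q_U x -> Q_U y -> Theta (x + y) = Theta x + Theta y.
  by move=> Qx Qy; rewrite -{1}[x]scale1r Theta_lin // scale1r.
have ThetaZ c x : Q_U x -> Theta (c *: x) = c *: Theta x.
  move=> Qx; rewrite -[c *: x]addr0 Theta_lin ?Theta0 ?addr0 //.
  exact: (alg0 ipK QU_alg).
have Theta_average x b : M x ->
    Theta (average dK t S pi p_pi x b) = cp_average dK t S pi p_pi x b.
  move=> Mx; rewrite /average ThetaZ; last first.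
    by apply: (alg_sum ipK QU_alg) => s _; exact: QU_tens.
  congr (_ *: _).
  pose Q X Y := Q_U X /\ Theta X = Y.
  suff: Q (\sum_s tens_op dK t (x \o S s) (b \o pure_rep pi p_pi s)%VF)
          (\sum_s tens_op (l2_ip dK) (l2_tensor t) (cp_emb S x \o cp_shift s)
             (b \o pure_rep pi p_pi s)%VF) by case.
  apply: (big_ind2 Q) => [|X1 Y1 X2 Y2 [Q1 <-] [Q2 <-]|s _].
  - by split=> //; exact: (alg0 ipK QU_alg).
  - by split; [exact: (algD ipK QU_alg) | exact: ThetaD].
  - split; first exact: QU_tens.
    have QS : Q_U (tens_op dK t (S s) \1%VF).
      by apply: (QU_tens id); exact: (alg1 ipH M_alg).
    have Qx b' : Q_U (tens_op dK t x b').
      rewrite Q_U_def; apply: sub_vN_gen.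
        by left; exact: (tens_in ipH ipV ipK K_tensor M_alg).
      exact: (tens_bounded ipH ipV ipK K_tensor _ (Mb _ Mx)).
    (* A product of the two kinds of elements on which [Theta] is prescribed. *)
    have -> : tens_op dK t (x \o S s) (b \o pure_rep pi p_pi s)%VF =
        tens_op dK t x (b \o pure_rep pi p_pi s)%VF \o tens_op dK t (S s) \1%VF.
      by rewrite (tens_comp ipH ipV ipK K_tensor) ?comp_lfun1r //; exact: Mb.
    rewrite Theta_comp // Theta_Q // Theta_S.
    rewrite (tens_comp ip2H ipV ip2K t2P) ?comp_lfun1r //.
      exact/(cp_emb_bounded ipH S_rep)/Mb.
    exact: cp_shift_bounded.
(* Every [pure_rep] has range in that of [p_pi], so [B] and [b] give the same average; commutation
   of [B] with [p_pi] gives [p_pi b = b = b p_pi]. *)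
pose b := (B \o p_pi)%VF.
have pp v : p_pi (p_pi v) = p_pi v by exact: (proj_idem ipV p_pi_def).
have brE s : (B \o pure_rep pi p_pi s)%VF = (b \o pure_rep pi p_pi s)%VF.
  apply/lfunP => v; rewrite (comp_lfunE b) [RHS](comp_lfunE B p_pi).
  by rewrite (proj_pure_rep ipV pi_rep p_pi_def) comp_lfunE.
have TE : tens_op dK t A B \o P_U = average dK t S pi p_pi A b.
  rewrite (average_proj ipH ipV ipK K_tensor S_rep pi_rep p_pi_def B P_U_def (Mb _ A_M)).
  by rewrite /average; congr (_ *: _); apply: eq_bigr => s _; rewrite brE.
have bp : (b \o p_pi)%VF = b by apply/lfunP => v; rewrite !comp_lfunE pp.
have pb v : p_pi (b v) = b v.
  rewrite /b !comp_lfunE -[p_pi (B _)]/(p_pi (B (p_pi v))).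
  by have /lfunP/(_ (p_pi v)) := B_comm; rewrite !comp_lfunE pp.
move=> T; rewrite {}/T TE Theta_average //; split; first exact: QU_average.
  move=> /(trace_idealP ipH M_alg Tr_M_trace) Az.
  have Xz := cp_average_trace ipH ipV ipK K_tensor S_rep pi_rep p_pi_def
    M_alg Tr_M_trace Tr_CP_trace Tr_trace Tr_CP_pos Tr_CP_def Tr_def b Az.
  rewrite bp in Xz; split; first by eexists; exact: Xz.
  by rewrite (trace_val_ext ip2K (tens_End_alg _ _ _) Tr_trace Xz).
move=> A0 T0.
have Tr0 : Tr 0 = 0%E by exact: (trace0 ip2K (tens_End_alg _ _ _) Tr_trace).
(* Comparing entries cancels nonzero factors, so [A = 0] and [b = 0] are settled first; in the
   latter case [Tr_M A] may be infinite and its product with 0 is 0. *)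
have [->|/eqP An0] := eqVneq A 0.
  rewrite (cp_average0l ipH ipV ipK K_tensor _ _ S_rep) Tr0.
  by rewrite (trace0 ipH M_alg Tr_M_trace) mul0e.
have [b0|/eqP bn0] := eqVneq b 0.
  rewrite b0 (cp_average0r ipH ipV ipK K_tensor _ _ S_rep) ?Tr0; last exact: Mb.
  by rewrite -/b b0 ntrace0 /= mulr0 mule0.
(* Positivity of [T] makes it selfadjoint on [K], and [Theta] respects adjoints. *)
have ab_sym : adjoint (l2_ip dK) (cp_average dK t S pi p_pi A b)
    (cp_average dK t S pi p_pi A b).
  rewrite -Theta_average //; apply: Theta_adj; try exact: QU_average.
  apply: (positive_op_adjoint ipK) => //.
  by apply: (average_linear ipH ipV ipK K_tensor _ _ S_rep); exact: Mb.
have bpv v : b (p_pi v) = b v by rewrite -[in RHS]bp comp_lfunE.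
have Ab := Mb _ A_M.
have A_inv := cp_average_sym_left ipH ipV ipK K_tensor S_rep pi_rep p_pi_def
  Ab A0 An0 bn0 pb bpv ab_sym.
have b_comm := cp_average_sym_comm ipH ipV ipK K_tensor S_rep pi_rep p_pi_def
  Ab A0 An0 bn0 pb bpv ab_sym.
have b_pos : positive_op dV b.
  apply: (average_positive_right ipH ipV ipK K_tensor S_rep pi_rep p_pi_def
    Ab A0 An0 bn0 pb bpv ab_sym P_U_def).
    by move=> D D0; rewrite -Theta_average // D0.
  exact: T0.
exact: (cp_average_trace_positive ipH ipV ipK K_tensor S_rep pi_rep p_pi_def
  M_alg M_invariant Tr_M_trace Tr_CP_trace Tr_trace Tr_CP_pos Tr_CP_def Tr_def
  b_pos b_comm bp (And3 A_M A0 A_inv)).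
Qed.
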